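(* Let $(p_n)_{n\ge 1}$ denote the sequence of prime numbers in increasing order, $2=p_1<p_2<\cdots$. There exists an irrational real number $\alpha$ such that the sequence $(\alpha p_n)_{n\ge1}$ is not well-distributed modulo $1$.
   Context: For a real number $s$, write $\{s\}=s-\lfloor s\rfloor$. A real sequence $(s_n)_{n\ge1}$ is called well-distributed modulo $1$ if for every pair of real numbers $a,b$ with $0\le a<b\le 1$ one has \[ \lim_{N\to\infty}\sup_{m\in\mathbb N}\left|\frac{\#\{n\in[1,N]\cap\mathbb Z : a\le \{s_{n+m}\}\le b\}}{N}-(b-a)\right|=0. \] *)

(* Defs.v *)
From HB Require Import structures.
From mathcomp Require Import all_boot all_order all_algebra.
From mathcomp Require Import all_classical all_reals all_analysis.

Set Implicit Arguments.
Unset Strict Implicit.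
Unset Printing Implicit Defensive.

Import Order.TTheory GRing.Theory Num.Theory.
Import numFieldNormedType.Exports.

Local Open Scope classical_set_scope.
Local Open Scope ring_scope.

Lemma exists_prime_above (m : nat) : exists q : nat, (m < q)%N && prime q.
Proof. by have [q mq q_pr] := prime_above m; exists q; apply/andP. Qed.

(* The least prime greater than m. *)
Definition next_prime (m : nat) : nat := ex_minn (exists_prime_above m).

(* Indexed from 1: nth_prime 1 = 2, nth_prime 2 = 3, nth_prime 3 = 5;
   nth_prime 0 = 0 is a dummy value. *)
Definition nth_prime (n : nat) : nat := iter n next_prime 0%N.

Definition frac_part (R : realType) (x : R) : R := x - (Num.floor x)%:~R.

(* #{n in [1, N] : a <= {s_(n+m)} <= b} *)
Definition count_mod1 (R : realType) (s : nat -> R) (a b : R) (N m : nat)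
  : nat :=
  count (fun n => a <= frac_part (s (n + m)%N) <= b) (index_iota 1 N.+1).

(* Sequences are indexed from 1: the value s 0 is never used. For N > 0 and
   0 <= a < b <= 1 the set under sup is non-empty and bounded, so that the
   real-valued sup is the genuine supremum. *)
Definition well_distributed_mod1 (R : realType) (s : nat -> R) : Prop :=
  forall a b : R, 0 <= a -> a < b -> b <= 1 ->
    sup (range (fun m : nat =>
           `|(count_mod1 s a b N m)%:R / N%:R - (b - a)|)) @[N --> \oo]
      --> (0 : R).

(* Main.v *)
Require Import Defs.
From HB Require Import structures.
From mathcomp Require Import all_boot all_order all_algebra zify ring lra.
From mathcomp Require Import all_classical all_reals all_analysis.
From mathcomp Require Import borel_hierarchy.

(**
By Baire's theorem it is enough to show that, for every interval and every k, some x in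
the interval puts too few of k consecutive multiples x p_{m+1}, ..., x p_{m+k} into
[1/3, 2/3] modulo 1.

Suppose that no nontrivial combination of p_{m+1}, ..., p_{m+k} with coefficients in
[-3, 3] is small. Then, on the given interval, the Riesz product of the factors
1 + cos(2 pi p_{m+i} x) makes the p_{m+i} x behave like independent variables of density
1 + cos(2 pi t). Under this density the majorant (4/9)(1 - cos(2 pi t))^2 of the indicator
function of [1/3, 2/3] has mean 2/9 < 1/4 < 1/3.

Such an m is found by counting primes p up to X = 2^L. By Chebyshev's bound there are at
least X / (2L) of them, and most are followed by k - 1 further primes within a distance
D = O(L). A small combination of these k primes confines their gaps to O(D^(k-2)) vectors,
and by Brun's pure sieve each vector of gaps occurs for at most X / L^(k - 1/2 + o(1))
primes, so that only O(X / L^(3/2 - o(1))) primes are excluded.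
*)

Set Implicit Arguments.
Unset Strict Implicit.
Unset Printing Implicit Defensive.

Import Order.TTheory GRing.Theory Num.Theory.
Import numFieldNormedType.Exports.

(** * Chebyshev's bounds *)

Definition prime_count (a b : nat) : nat := count prime (index_iota a b).

Lemma bin_central_gt0 n : 0 < 'C(n.*2, n).
Proof. by rewrite bin_gt0 -addnn leq_addr. Qed.

Lemma logn_bin_central_le p n : prime p ->
  logn p 'C(n.*2, n) <= trunc_log p n.*2.
Proof.
move=> pp; have p1 := prime_gt1 pp.
have nn : n <= n.*2 by rewrite -addnn leq_addr.
have small k : n < k -> n %/ p ^ k = 0.
  by move=> nk; apply: divn_small; apply: leq_trans nk _; apply/ltnW/ltn_expl.
have := congr1 (logn p) (bin_fact nn).
rewrite -{2}addnn addnK !lognM ?muln_gt0 ?fact_gt0 ?bin_central_gt0 //.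
rewrite !logn_fact // => E.
have ext : \sum_(1 <= k < n.*2.+1) n %/ p ^ k = \sum_(1 <= k < n.+1) n %/ p ^ k.
  rewrite (@big_cat_nat _ _ _ n.+1) //= [X in _ + X]big_nat_cond [X in _ + X]big1 ?addn0 //.
  by move=> k /andP[/andP[nk _] _]; exact: small.
have H : \sum_(1 <= k < n.*2.+1) n.*2 %/ p ^ k <=
   \sum_(1 <= k < n.*2.+1) (n %/ p ^ k + n %/ p ^ k + (k <= trunc_log p n.*2)).
  apply: leq_sum => k _; case: (leqP k (trunc_log p n.*2)) => kt /=.
    by rewrite -addnn divnD ?expn_gt0 ?prime_gt0 // leq_add2l leq_b1.
  rewrite divn_small //.
  rewrite ltnNge; apply/negP => /(trunc_log_max p1); lia.
rewrite !big_split /= ext -E in H.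
have cnt m t : \sum_(1 <= k < m.+1) (k <= t) <= t.
  have -> : \sum_(1 <= k < m.+1) (k <= t) = minn m t.
    elim: m => [|m IH]; first by rewrite big_geq ?min0n.
    by rewrite big_nat_recr //= IH; lia.
  lia.
have := cnt n.*2 (trunc_log p n.*2); lia.
Qed.

Lemma pfactor_bin_central_le p n : 0 < n -> prime p ->
  p ^ logn p 'C(n.*2, n) <= n.*2.
Proof.
move=> n0 pp; have := trunc_logP (prime_gt1 pp) (n := n.*2).
rewrite double_gt0 n0 => /(_ isT); apply: leq_trans.
by rewrite leq_exp2l ?prime_gt1 // logn_bin_central_le.
Qed.

Lemma bin_central_prod n : 0 < n ->
  'C(n.*2, n) = \prod_(0 <= p < n.*2.+1 | prime p) p ^ logn p 'C(n.*2, n).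
Proof.
move=> n0; have C0 := bin_central_gt0 n.
set C := 'C(n.*2, n).
have E : C = \prod_(0 <= p < (C + n.*2).+1 | prime p) p ^ logn p C.
  rewrite -{1}(@part_pnat_id [pred p | prime p] C).
    by rewrite (@widen_partn (C + n.*2)) ?leq_addr //.
  by apply/pnatP => // p.
rewrite {1}E (@big_cat_nat _ _ _ n.*2.+1) //=; last by rewrite ltnS leq_addl.
rewrite [X in _ * X]big_nat_cond [X in _ * X]big1 ?muln1 //.
move=> p /andP[/andP[np _] pp].
case E': (logn p C) => [|e] //.
have := pfactor_bin_central_le n0 pp; rewrite -/C E' expnS => le1.
have : p <= p * p ^ e by rewrite leq_pmulr // expn_gt0 prime_gt0.
lia.
Qed.

Lemma leq_prod_prime_expn (f : nat -> nat) c a b :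
  (forall p, a <= p < b -> prime p -> f p <= c) ->
  \prod_(a <= p < b | prime p) f p <= c ^ prime_count a b.
Proof.
move=> H; rewrite /prime_count big_mkcond /index_iota.
have : forall p, p \in iota a (b - a) -> prime p -> f p <= c.
  by move=> p; rewrite mem_iota => hp; apply: H; lia.
elim: (iota a (b - a)) => [|p s IH] Hs; first by rewrite big_nil.
have IH' : \prod_(i <- s) (if prime i then f i else 1) <= c ^ count prime s.
  by apply: IH => q qs; apply: Hs; rewrite inE qs orbT.
rewrite big_cons /=; case: ifP => pp /=; last by rewrite mul1n add0n.
by rewrite add1n expnS leq_mul // Hs // mem_head.
Qed.

Lemma geq_prod_prime_expn (f : nat -> nat) c a b :
  (forall p, a <= p < b -> prime p -> c <= f p) ->
  c ^ prime_count a b <= \prod_(a <= p < b | prime p) f p.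
Proof.
move=> H; rewrite /prime_count big_mkcond /index_iota.
have : forall p, p \in iota a (b - a) -> prime p -> c <= f p.
  by move=> p; rewrite mem_iota => hp; apply: H; lia.
elim: (iota a (b - a)) => [|p s IH] Hs; first by rewrite big_nil.
have IH' : c ^ count prime s <= \prod_(i <- s) (if prime i then f i else 1).
  by apply: IH => q qs; apply: Hs; rewrite inE qs orbT.
rewrite big_cons /=; case: ifP => pp /=; last by rewrite mul1n add0n.
by rewrite add1n expnS leq_mul // Hs // mem_head.
Qed.

Lemma expn2_le_bin_central n : 2 ^ n <= 'C(n.*2, n).
Proof.
elim: n => [|n IH] //.
have -> : n.+1.*2 = n.*2.+2 by lia.
rewrite expnS binS [X in X + _]binS.
case: n IH => [|n] // IH; rewrite [X in _ + X]binS; lia.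
Qed.

Lemma bin_le_expn2 n m : 'C(n, m) <= 2 ^ n.
Proof.
elim: n m => [|n IH] [|m]; rewrite ?bin0 ?expn_gt0 ?bin0n //.
by rewrite binS expnS mul2n -addnn leq_add.
Qed.

Lemma chebyshev_upper n : 0 < n -> n ^ prime_count n.+1 n.*2.+1 <= 2 ^ n.*2.
Proof.
move=> n0; apply: leq_trans (bin_le_expn2 n.*2 n).
rewrite (bin_central_prod n0) (@big_cat_nat _ _ _ n.+1) //=; last first.
  by rewrite ltnS -addnn leq_addr.
have C0 := bin_central_gt0 n.
apply: leq_trans (leq_pmull _ _); last first.
  rewrite prodn_cond_gt0 // => p pp; by rewrite expn_gt0 prime_gt0.
apply: geq_prod_prime_expn => p /andP[np p2n] pp.
have pdvd : p %| 'C(n.*2, n).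
  have nn : n <= n.*2 by rewrite -addnn leq_addr.
  have : p %| (n.*2)`! by rewrite dvdn_fact // prime_gt0.
  rewrite -(bin_fact nn) -{2}addnn addnK Euclid_dvdM // => /orP[//|].
  rewrite Euclid_dvdM // orbb => pf; exfalso.
  have : 0 < logn p n`! by rewrite logn_gt0 mem_primes pp fact_gt0.
  rewrite logn_fact // big_nat_cond big1 //.
  move=> k /andP[/andP[k0 _] _]; apply: divn_small.
  by apply: leq_trans np _; rewrite -{1}(expn1 p) leq_exp2l ?prime_gt1.
apply: leq_trans (ltnW np) _; rewrite -{1}(expn1 p) leq_exp2l ?prime_gt1 //.
by rewrite logn_gt0 mem_primes pp C0.
Qed.

Lemma chebyshev_lower n : 0 < n -> 2 ^ n <= n.*2 ^ prime_count 0 n.*2.+1.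
Proof.
move=> n0; apply: leq_trans (expn2_le_bin_central n) _.
rewrite {1}(bin_central_prod n0); apply: leq_prod_prime_expn => p _ pp.
exact: pfactor_bin_central_le.
Qed.

Lemma prime_count_pow2_ge L : 0 < L -> 2 ^ L <= L.*2 * prime_count 0 (2 ^ L).+1.
Proof.
case: L => // L _; have := @chebyshev_lower (2 ^ L); rewrite expn_gt0 => /(_ isT).
have -> : (2 ^ L).*2 = 2 ^ L.+1 by rewrite expnS mul2n.
rewrite -expnM leq_exp2l // expnS; lia.
Qed.

Lemma prime_count_dyadic_le i : i * prime_count (2 ^ i).+1 (2 ^ i.+1).+1 <= 2 ^ i.+1.
Proof.
have := @chebyshev_upper (2 ^ i); rewrite expn_gt0 => /(_ isT).
have -> : (2 ^ i).*2 = 2 ^ i.+1 by rewrite expnS mul2n.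
by rewrite -expnM leq_exp2l.
Qed.

(** * Consecutive primes *)

Definition isolated_prime (k D p : nat) : bool :=
  prime p && (prime_count p.+1 (p + D).+1 < k).

Lemma count_isolated_block k D a : count (isolated_prime k D) (iota a D) <= k.
Proof.
rewrite -size_filter; set s := seq.filter _ _.
have Ss : sorted ltn s by apply: sorted_filter; [exact: ltn_trans | exact: iota_ltn_sorted].
have Hs p : p \in s -> isolated_prime k D p /\ a <= p < a + D.
  by rewrite mem_filter mem_iota => /andP[].
case E : s Ss Hs => [|p s'] //= Ss Hs.
have [/andP[pp pk] pa] := Hs p (mem_head _ _).
apply: leq_ltn_trans pk; rewrite /prime_count -size_filter; apply: uniq_leq_size.
  have : uniq s by rewrite filter_uniq // iota_uniq.
  by rewrite E /= => /andP[].
move=> q qs; have [/andP[qp _] qa] : isolated_prime k D q /\ a <= q < a + D.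
  by apply: Hs; rewrite inE qs orbT.
have /allP/(_ q qs) pq : all (ltn p) s' by apply: order_path_min Ss; exact: ltn_trans.
rewrite mem_filter qp mem_index_iota /= in pq *; lia.
Qed.

Lemma count_isolated k D X : 0 < D ->
  count (isolated_prime k D) (iota 0 X) <= k * (X %/ D).+1.
Proof.
move=> D0; apply: leq_trans (_ : count (isolated_prime k D) (iota 0 (D * (X %/ D).+1)) <= _).
  have /subnKC <- : X <= D * (X %/ D).+1 by rewrite mulnC ltnW // ltn_ceil.
  by rewrite iotaD count_cat leq_addr.
elim: (X %/ D).+1 => [|b IH]; first by rewrite !muln0.
rewrite mulnS addnC iotaD count_cat mulnS addnC add0n.
by apply: leq_add => //; exact: count_isolated_block.
Qed.

Lemma count_le_sum_count (I : finType) (A : {set I}) (P : pred nat) (Q : I -> pred nat) s :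
  (forall x, x \in s -> P x -> exists2 i, i \in A & Q i x) ->
  count P s <= \sum_(i in A) count (Q i) s.
Proof.
elim: s => [|x s IH] H //=.
under eq_bigr do rewrite /=.
rewrite big_split /=; apply: leq_add; last first.
  by apply: IH => y ys; apply: H; rewrite inE ys orbT.
case: (boolP (P x)) => // Px; have [i iA Qi] := H x (mem_head _ _) Px.
by rewrite (bigD1 i) //= Qi.
Qed.

Lemma prime_count_cat a b c : a <= b -> b <= c ->
  prime_count a c = prime_count a b + prime_count b c.
Proof.
move=> ab bc; rewrite /prime_count /index_iota -count_cat.
have -> : c - a = (b - a) + (c - b) by lia.
by rewrite iotaD subnKC.
Qed.

Lemma next_primeP m :
  [/\ m < next_prime m, prime (next_prime m) &
      forall q, m < q -> prime q -> next_prime m <= q].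
Proof.
rewrite /next_prime; case: ex_minnP => q /andP[mq pq] H; split=> // q' mq' pq'.
by apply: H; rewrite mq' pq'.
Qed.

Lemma prime_count_nth_prime n : prime_count 0 (nth_prime n).+1 = n.
Proof.
elim: n => [|n IH] //.
have [lt pr mn] := next_primeP (nth_prime n).
rewrite /nth_prime iterS -/(nth_prime n).
rewrite (@prime_count_cat 0 (nth_prime n).+1) ?IH //; last by rewrite ltnS ltnW.
rewrite (@prime_count_cat _ (next_prime (nth_prime n))) //.
rewrite {2}/prime_count /index_iota subSnn /= pr.
rewrite /prime_count (_ : count _ _ = 0) ?addn0 ?addn1 //.
apply/eqP; rewrite -leqn0 leqNgt -has_count; apply/hasP => -[q].
by rewrite mem_index_iota => /andP[q1 q2] pq; have := mn q q1 pq; lia.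
Qed.

Lemma prime_nth_prime n : prime (nth_prime n.+1).
Proof. by have [] := next_primeP (nth_prime n). Qed.

Lemma prime_count_ltn a b : prime b -> a < b -> prime_count 0 a.+1 < prime_count 0 b.+1.
Proof.
move=> pb ab; rewrite (@prime_count_cat 0 a.+1 b.+1) //; last by rewrite ltnS ltnW.
rewrite -{1}[prime_count 0 a.+1]addn0 ltn_add2l (@prime_count_cat _ b) //.
by rewrite {2}/prime_count /index_iota subSnn /= pb addn1.
Qed.

Lemma nth_prime_count p : prime p -> nth_prime (prime_count 0 p.+1) = p.
Proof.
move=> pp; set m := prime_count 0 p.+1.
have : prime_count 0 (nth_prime m).+1 = prime_count 0 p.+1 by exact: prime_count_nth_prime.
have m0 : 0 < m by have := prime_count_ltn pp (prime_gt0 pp).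
have pm : prime (nth_prime m) by case: (m) m0 => // m' _; exact: prime_nth_prime.
case: (ltngtP (nth_prime m) p) => // h e.
  by have := prime_count_ltn pp h; rewrite e ltnn.
by have := prime_count_ltn pm h; rewrite e ltnn.
Qed.

Lemma nth_prime_homo : {homo nth_prime : m n / m < n}.
Proof. by apply: homo_ltn; [exact: ltn_trans | move=> m; have [] := next_primeP (nth_prime m)]. Qed.

Lemma nth_prime_window p D j : prime p -> j <= prime_count p.+1 (p + D).+1 ->
  nth_prime (prime_count 0 p.+1 + j) <= p + D.
Proof.
move=> pp; case: j => [|j] h; first by rewrite addn0 nth_prime_count // leq_addr.
rewrite leqNgt; apply/negP => lt; rewrite addnS in lt.
have := prime_count_ltn (prime_nth_prime _) lt.
rewrite prime_count_nth_prime (@prime_count_cat 0 p.+1) //; last by rewrite ltnS leq_addr.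
lia.
Qed.

(** * Choice of the sieve parameters *)

Lemma poly_le_expn2 a c : exists t0, forall t, t0 <= t -> a * t.+1 ^ c <= 2 ^ t.
Proof.
exists (c.+1 * (a * c.+1 ^ c)) => t ht.
set w := t %/ c.+1.
have hw : a * c.+1 ^ c <= w by rewrite /w leq_divRL // mulnC.
have h1 : t.+1 <= c.+1 * 2 ^ w.
  apply: leq_trans (_ : c.+1 * w.+1 <= _); first by rewrite mulnC ltn_ceil.
  by rewrite leq_mul2l ltn_expl.
have h2 : t.+1 ^ c <= c.+1 ^ c * 2 ^ (w * c).
  by rewrite expnM -expnMn; case: (posnP c) => [->//|c0]; rewrite leq_exp2r.
have h3 : c.+1 * w <= t by rewrite mulnC leq_divM.
apply: leq_trans (_ : a * (c.+1 ^ c * 2 ^ (w * c)) <= _); first by rewrite leq_mul2l h2 orbT.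
rewrite mulnA; apply: leq_trans (_ : 2 ^ w * 2 ^ (w * c) <= _).
  by rewrite leq_mul2r (leq_trans hw) ?orbT // ltnW // ltn_expl.
by rewrite -expnD leq_exp2l // -mulnS mulnC.
Qed.

Lemma affine_le lin c0 c1 t x : c0 <= lin -> c1 <= lin -> x = c0 + c1 * t -> x <= lin * t.+1.
Proof. by move=> h0 h1 ->; rewrite mulnS leq_add // leq_mul. Qed.

(* For [k = n.+2] and large [t]: [L = 2 ^ (2 * k * t)], [J = L ^ (1 - 1 / (2 * k))],
   [r = 2 ^ t.-1], and [2 ^ i] is a constant multiple of [L]. *)
Lemma sieve_parameters n H : exists i J L r,
  let M := 7 ^ n.+1 * n.+1 * H.*2.+1 * (2 ^ i).+1 ^ n in
  [/\ [&& 3 <= i, i <= J, n.+2 <= 2 ^ i, ~~ odd r & 0 < L],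
      32 * L * M * (18 * i ^ 4) ^ n.+2 <= J ^ n.+2,
      32 * L * M * (3 * J ^ 2) ^ (2 * n.+2) <= 2 ^ r.+1,
      16 * L * M * (1 + n.+2 * 2 ^ J) ^ r <= 2 ^ L
    & (32 * n.+1 * L <= 2 ^ i) &&
      (16 * L * (n.+1 + (2 ^ J + H + 3 * n.+2 * 2 ^ i).+1) <= 2 ^ L)].
Proof.
have [k kE] : exists k, k = n.+2 by exists n.+2.
have [g gE] : exists g, 2 * k = g.+1 by exists (2 * k).-1; lia.
pose e := 5 + n.+1; pose m := 7 ^ n.+1 * n.+1 * H.*2.+1.
pose lin := (5 + m + e.+1 * n + 4 * k) + (2 * k + 2 * k * n + 4 * k * g)
  + (6 + n + H + 3 * k + e) + 4 * k + k.+1.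
have [t [t2 ht1 ht2]] : exists t, [/\ 2 <= t,
    2 ^ (5 + m + e.+1 * n + 5 * k) * (2 * k + e) ^ (4 * k) * t.+1 ^ (4 * k) <= 2 ^ t
  & 2 * lin * t.+1 ^ 1 <= 2 ^ t].
  have [t1 ht1] := poly_le_expn2 (2 ^ (5 + m + e.+1 * n + 5 * k) * (2 * k + e) ^ (4 * k)) (4 * k).
  have [t2 ht2] := poly_le_expn2 (2 * lin) 1.
  by exists (maxn t1 t2).+2; split=> //; [apply: ht1 | apply: ht2]; lia.
have tE : t = t.-1.+1 by lia.
have [i iE] : exists i, i = e + 2 * k * t by exists (e + 2 * k * t).
pose J := 2 ^ (g * t); pose L := 2 ^ (2 * k * t); pose r := 2 ^ t.-1.
have tr : 2 ^ t = 2 * r by rewrite /r -expnS -tE.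
have LJ : L = 2 * r * J by rewrite /L /J -tr -expnD gE; congr (2 ^ _); lia.
have lin_r : lin * t.+1 <= r.
  by move: ht2; rewrite tr expn1 -mulnA leq_pmul2l.
have g0 : 0 < g by lia.
have rJ : r <= J.
  by rewrite /r /J leq_exp2l //; apply: leq_trans (leq_pred _) (leq_pmull _ g0).
have r0 : 0 < r by rewrite expn_gt0.
have J0 : 0 < J by rewrite expn_gt0.
have Mle : m * (2 ^ i).+1 ^ n <= 2 ^ (m + i.+1 * n).
  rewrite expnD leq_mul //; first by rewrite ltnW // ltn_expl.
  rewrite expnM; case: (posnP n) => [->//|n0]; rewrite leq_exp2r // expnS.
  have : 0 < 2 ^ i by rewrite expn_gt0.
  lia.
have e32 : 32 * n.+1 <= 2 ^ e.
  by rewrite /e expnD leq_mul // ltnW // ltn_expl.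
have i_lin : i <= lin * t.+1 by apply: affine_le iE; rewrite /lin; clear; lia.
have i_poly : i <= (2 * k + e) * t.+1 by apply: affine_le iE; clear; lia.
have kJ : k.+1 <= J.
  apply: leq_trans rJ; apply: leq_trans lin_r; apply: leq_trans (leq_pmulr _ _) => //.
  by rewrite /lin; clear; lia.
have E5 : 32 * L * (m * (2 ^ i).+1 ^ n) <= 2 ^ (5 + 2 * k * t + (m + i.+1 * n)).
  by rewrite [leqRHS]expnD leq_mul // expnD.
have E4 : 16 * L * (m * (2 ^ i).+1 ^ n) <= 2 ^ (4 + 2 * k * t + (m + i.+1 * n)).
  by rewrite [leqRHS]expnD leq_mul // expnD.
have k0 : 0 < k by rewrite kE.
exists i, J, L, r => /=; rewrite -/m -kE; split.
- apply/and5P; split; rewrite ?expn_gt0 //.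
  + by rewrite iE /e.
  + by apply: leq_trans i_lin (leq_trans lin_r rJ).
  + apply: leq_trans (_ : 2 ^ e <= _); first by move: e32; rewrite kE; clear; lia.
    by rewrite leq_exp2l // iE leq_addr.
  + by rewrite /r oddX /= orbF -lt0n -ltnS -tE.
- apply: leq_trans (leq_mul E5 (_ : _ <= 2 ^ (5 * k) * ((2 * k + e) * t.+1) ^ (4 * k))) _.
    rewrite expnMn -expnM; apply: leq_mul.
      by rewrite expnM leq_exp2r.
    by rewrite leq_exp2r // muln_gt0.
  rewrite (_ : 5 + _ + _ = (5 + m + e.+1 * n) + 2 * k * t * n.+1); last by rewrite iE; clear; lia.
  have -> : J ^ k = 2 ^ (2 * k * t * n.+1) * 2 ^ (k * t).
    rewrite /J -expnM -expnD; congr (2 ^ _).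
    have -> : g * t * k = (g * k) * t by clear; lia.
    have -> : 2 * k * t * n.+1 + k * t = (2 * k * n.+1 + k) * t by clear; lia.
    congr (_ * _); have -> : 2 * k * n.+1 = g.+1 * n.+1 by rewrite gE.
    have -> : n.+1 = k.-1 by rewrite kE.
    clear - k0 gE; case: k k0 gE => // k' _ gE; nia.
  have -> x y z w c : 2 ^ (x + y) * (2 ^ z * (w * c) ^ (4 * k)) =
      2 ^ y * (2 ^ (x + z) * w ^ (4 * k) * c ^ (4 * k)).
    by rewrite !expnD expnMn; clear; lia.
  rewrite leq_mul2l; apply/orP; right.
  by apply: leq_trans ht1 _; rewrite leq_exp2l // leq_pmull.
- apply: leq_trans (leq_mul E5 (_ : _ <= 2 ^ ((2 + g * t * 2) * (2 * k)))) _.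
    rewrite [leqRHS]expnM leq_exp2r ?muln_gt0 ?k0 // expnD leq_mul // /J -expnM //.
  rewrite -expnD leq_exp2l //; apply: leq_trans (leqnSn r); apply: leq_trans lin_r.
  apply: (@affine_le _ (5 + m + e.+1 * n + 4 * k) (2 * k + 2 * k * n + 4 * k * g)).
  + by rewrite /lin; clear; lia.
  + by rewrite /lin; clear; lia.
  + by rewrite iE; clear; lia.
- apply: leq_trans (leq_mul E4 (_ : _ <= 2 ^ ((J + k) * r))) _.
    rewrite [leqRHS]expnM leq_exp2r //.
    have kk : k.+1 <= 2 ^ k by rewrite ltn_expl.
    have J1 : 0 < 2 ^ J by rewrite expn_gt0.
    apply: leq_trans (_ : k.+1 * 2 ^ J <= _); first by rewrite mulSn leq_add2r.
    by rewrite expnD mulnC leq_mul2l kk orbT.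
  rewrite -expnD leq_exp2l // LJ.
  have h : 4 + 2 * k * t + (m + i.+1 * n) <= r.
    apply: leq_trans lin_r.
    apply: (@affine_le _ (4 + m + e.+1 * n) (2 * k + 2 * k * n)).
    + by rewrite /lin; clear; lia.
    + by rewrite /lin; clear; lia.
    + by rewrite iE; clear; lia.
  apply: leq_trans (leq_add h (leqnn _)) _.
  have : r * k.+1 <= r * J by rewrite leq_mul2l kJ orbT.
  by clear; lia.
- apply/andP; split.
    by rewrite iE expnD leq_mul2r e32 orbT.
  apply: leq_trans (_ : 2 ^ (4 + 2 * k * t) * 2 ^ (n.+2 + H + J + (3 * k + i)) <= _).
    rewrite expnD (_ : 2 ^ 4 = 16) // leq_mul2l; apply/orP; right.
    rewrite 2!expnD [2 ^ (3 * k + i)]expnD.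
    have h1 : n.+2 + H < 2 ^ (n.+2 + H) by rewrite ltn_expl.
    have h2 : J < 2 ^ J by rewrite ltn_expl.
    have h3 : 3 * k * 2 ^ i <= 2 ^ (3 * k) * 2 ^ i by rewrite leq_mul2r ltnW ?orbT // ltn_expl.
    have h4 : 2 <= 2 ^ (3 * k) * 2 ^ i.
      by rewrite -expnD -{1}(expn1 2) leq_exp2l // ltn_addr // muln_gt0.
    have h0 : n.+1 + (2 ^ J + H + 3 * k * 2 ^ i).+1 = (n.+2 + H) + 2 ^ J + 3 * k * 2 ^ i by clear; lia.
    rewrite h0.
    apply: leq_trans (leq_add (leq_add (ltnW h1) (leqnn _)) h3) _.
    have {}h1 : 2 <= 2 ^ (n.+2 + H) by clear - h1; lia.
    have {}h2 : 2 <= 2 ^ J by clear - h2 J0; lia.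
    move: h1 h2 h4; move: (2 ^ (n.+2 + H)) (2 ^ J) (_ * 2 ^ i) => x y z h1 h2 h4.
    have h5 : x + y <= x * y by clear - h1 h2; nia.
    have h6 : x * y + z <= x * y * z by clear - h1 h2 h4; nia.
    by clear - h5 h6; lia.
  rewrite -expnD leq_exp2l // LJ.
  have h : 4 + 2 * k * t + (n.+2 + H + (3 * k + i)) <= r.
    apply: leq_trans lin_r.
    apply: (@affine_le _ (6 + n + H + 3 * k + e) (4 * k)).
    + by rewrite /lin; clear; lia.
    + by rewrite /lin; clear; lia.
    + by rewrite iE; clear; lia.
  have h' : r + J <= 2 * r * J by clear - r0 J0; nia.
  by clear - h h'; lia.
Qed.

Local Open Scope ring_scope.

(** * Products over primes *)

Definition euler_prod (R : realFieldType) (a b : nat) : R :=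
  \prod_(a <= p < b | prime p) (1 - p%:R^-1).

Definition euler_prod_pos (R : realFieldType) (a b : nat) : R :=
  \prod_(a <= p < b | prime p) (1 + p%:R^-1).

Section Mertens.
Variable R : realFieldType.

Definition smooth_recip_sum (ps : seq nat) (z : nat) : R :=
  \sum_(1 <= m < z.+1 | all [in ps] (primes m)) m%:R^-1.

Lemma invnat_ge0 m : 0 <= (m%:R : R)^-1. Proof. by rewrite invr_ge0 ler0n. Qed.

(* A [p :: ps]-smooth integer is either [ps]-smooth or [p] times a [p :: ps]-smooth one. *)
Lemma smooth_recip_sum_cons p ps z : prime p ->
  (1 - p%:R^-1) * smooth_recip_sum (p :: ps) z <= smooth_recip_sum ps z.
Proof.
move=> pp; set S := smooth_recip_sum (p :: ps) z.
suff : S <= smooth_recip_sum ps z + p%:R^-1 * S.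
  by rewrite mulrBl mul1r lerBlDr addrC.
rewrite {1}/S /smooth_recip_sum (bigID (fun m => p %| m)%N) /= addrC lerD //.
  rewrite big_mkcond [leRHS]big_mkcond /=; apply: ler_sum => m _.
  case: ifP => [/andP[Hm pm]|_]; last by case: ifP => _ //; exact: invnat_ge0.
  case: ifP => // /negP[]; apply/allP => q qm.
  move/allP: Hm => /(_ q qm); rewrite /= inE => /orP[/eqP E|//].
  by move: qm; rewrite E mem_primes (negbTE pm) !andbF.
rewrite /S /smooth_recip_sum mulr_sumr.
set A := [in p :: ps].
have step m : (1 <= m < z.+1)%N ->
  (if all A (primes m) && (p %| m)%N then (m%:R : R)^-1 else 0) <=
  \sum_(1 <= m' < z.+1) (m == p * m')%N%:R *
     (if all A (primes m') then p%:R^-1 * m'%:R^-1 else 0 : R).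
  move=> /andP[m1 mz].
  have p0 := prime_gt0 pp.
  have ge0 i : 0 <= (m == p * i)%N%:R *
     (if all A (primes i) then p%:R^-1 * i%:R^-1 else 0 : R).
    by rewrite mulr_ge0 ?ler0n //; case: ifP => // _; rewrite mulr_ge0 ?invnat_ge0.
  case: ifP => [/andP[Hm pm]|_]; last by apply: sumr_ge0 => i _; exact: ge0.
  have [m' E] := dvdnP pm.
  have m'0 : (0 < m')%N by case: (m') E m1 => //; lia.
  have m'z : (m' < z.+1)%N by apply: leq_ltn_trans mz; rewrite E; apply: leq_pmulr.
  rewrite (bigD1_seq m') ?iota_uniq ?mem_index_iota ?m'0 //=.
  rewrite -[leLHS]addr0; apply: lerD; last by apply: sumr_ge0 => i _; exact: ge0.
  rewrite E mulnC eqxx mul1r ifT ?natrM ?invfM //.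
  apply/allP => q; rewrite mem_primes => /and3P[qp _ qm].
  move/allP: Hm; apply; rewrite mem_primes qp m1 E /= dvdn_mulr //.
rewrite big_mkcond /=.
apply: le_trans (ler_sum_nat (fun m hm => step m hm)) _.
rewrite exchange_big_nat /= [leRHS]big_mkcond /=; apply: ler_sum => i _.
rewrite -mulr_suml.
set G := (if _ then _ else _); have G0 : 0 <= G.
  by rewrite /G; case: ifP => // _; rewrite mulr_ge0 ?invnat_ge0.
rewrite -[leRHS]mul1r; apply: ler_wpM2r => //.
rewrite -natr_sum -[1]/(1%:R) ler_nat.
have -> : (\sum_(1 <= m < z.+1) (m == p * i) = count_mem (p * i) (index_iota 1 z.+1))%N.
  by rewrite -sum1_count [RHS]big_mkcond; apply: eq_bigr => m _ /=; case: (m == _).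
by rewrite count_uniq_mem ?iota_uniq ?leq_b1.
Qed.

Lemma prod_smooth_recip_sum_le1 ps z : all prime ps ->
  (\prod_(p <- ps) (1 - p%:R^-1)) * smooth_recip_sum ps z <= 1.
Proof.
elim: ps => [_|p ps IH /= /andP[pp Hps]].
  rewrite big_nil mul1r /smooth_recip_sum.
  case: z => [|z]; first by rewrite big_geq.
  rewrite big_mkcond big_nat_recl //= invr1 big_nat_cond big1 ?addr0 //.
  move=> m /andP[/andP[m1 _] _]; rewrite -/(primes m.+1).
  have := primes_eq0 m.+1; case: (primes m.+1) => //=; rewrite eqxx; lia.
apply: le_trans (IH Hps); rewrite big_cons [X in X * _]mulrC -mulrA.
apply: ler_wpM2l; last exact: smooth_recip_sum_cons.
rewrite big_seq; apply: prodr_ge0 => q qs.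
rewrite subr_ge0 invf_le1 ?ltr0n ?ler1n ?prime_gt0 //; exact: (allP Hps).
Qed.

Lemma harmonic_pow2_ge J : J%:R / 2 <= \sum_(1 <= m < (2 ^ J).+1) (m%:R : R)^-1.
Proof.
elim: J => [|J IH]; first by rewrite mul0r sumr_ge0 // => i _; exact: invnat_ge0.
rewrite (@big_cat_nat _ _ _ (2 ^ J).+1) //=; last by rewrite ltnS leq_exp2l.
rewrite -natr1 mulrDl; apply: lerD => //.
have E : ((2 ^ J.+1).+1 = (2 ^ J).+1 + 2 ^ J)%N by rewrite expnS; lia.
apply: le_trans (_ : \sum_((2 ^ J).+1 <= m < (2 ^ J.+1).+1) (2 ^ J.+1)%:R^-1 <= _).
  rewrite sumr_const_nat E addKn -mulr_natr expnS natrM.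
  have h : (2 ^ J)%:R != 0 :> R by rewrite pnatr_eq0 expn_eq0.
  by rewrite le_eqVlt; apply/orP; left; apply/eqP; field.
apply: ler_sum_nat => m /andP[m1 m2].
rewrite lef_pV2 ?ler_nat ?posrE ?ltr0n ?expn_gt0 //; lia.
Qed.

Lemma euler_prod_ge0 a b : 0 <= euler_prod R a b.
Proof.
apply: prodr_ge0 => p pp.
by rewrite subr_ge0 invf_le1 ?ltr0n ?ler1n ?prime_gt0.
Qed.

Lemma mertens_upper J : J%:R / 2 * euler_prod R 0 (2 ^ J).+1 <= 1.
Proof.
set z := (2 ^ J)%N; pose ps := [seq p <- index_iota 0 z.+1 | prime p].
have := @prod_smooth_recip_sum_le1 ps z (filter_all _ _).
rewrite big_filter mulrC; apply: le_trans.
apply: ler_wpM2r; first exact: euler_prod_ge0.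
apply: le_trans (harmonic_pow2_ge J) _; rewrite -/z /smooth_recip_sum.
rewrite [leRHS]big_mkcond; apply: ler_sum_nat => m /andP[m1 m2].
rewrite ifT //; apply/allP => q; rewrite mem_primes => /and3P[qp _ qm].
rewrite mem_filter qp mem_index_iota /=.
exact: leq_ltn_trans (dvdn_leq m1 qm) m2.
Qed.

Lemma euler_prod_inv b : 1 <= euler_prod R 0 b * euler_prod_pos R 0 b ^+ 2.
Proof.
rewrite /euler_prod /euler_prod_pos -prodrXl -big_split /=.
rewrite -[leLHS](@big1_eq _ _ *%R _ (index_iota 0 b) prime) //.
apply: ler_prod => p pp; rewrite ler01 /=.
have p2 : (p%:R : R)^-1 <= 2^-1.
  by rewrite lef_pV2 ?posrE ?ltr0n ?prime_gt0 // ler_nat prime_gt1.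
have := invnat_ge0 p; set x := _^-1 in p2 *; nra.
Qed.

Lemma euler_prod_pos_cat a b c : (a <= b)%N -> (b <= c)%N ->
  euler_prod_pos R a c = euler_prod_pos R a b * euler_prod_pos R b c.
Proof. by move=> ab bc; rewrite /euler_prod_pos (@big_cat_nat _ _ _ b). Qed.

Lemma euler_prod_cat a b c : (a <= b)%N -> (b <= c)%N ->
  euler_prod R a c = euler_prod R a b * euler_prod R b c.
Proof. by move=> ab bc; rewrite /euler_prod (@big_cat_nat _ _ _ b). Qed.

Lemma euler_prod_pos_ge1 a b : 1 <= euler_prod_pos R a b.
Proof.
rewrite -[leLHS](@big1_eq _ _ *%R _ (index_iota a b) prime) //.
by apply: ler_prod => p pp; rewrite ler01 lerDl invnat_ge0.
Qed.

Lemma exp1D_le (x : R) n : 0 <= x -> n%:R * x < 1 -> (1 + x) ^+ n * (1 - n%:R * x) <= 1.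
Proof.
move=> x0 nx; elim: n nx => [|n IH] nx; first by rewrite expr0 mul0r subr0 mul1r.
have n0 : 0 <= n%:R :> R by rewrite ler0n.
have nx' : n%:R * x < 1 by rewrite -natr1 in nx; nra.
apply: le_trans (IH nx'); rewrite exprSr -mulrA; apply: ler_wpM2l.
  by rewrite exprn_ge0 // addr_ge0.
rewrite -natr1; nra.
Qed.

Lemma euler_prod_pos_dyadic i : (3 <= i)%N ->
  (i%:R - 2) * euler_prod_pos R (2 ^ i).+1 (2 ^ i.+1).+1 <= i%:R.
Proof.
move=> i3; set x : R := (2 ^ i)%:R^-1.
have x0 : 0 < x by rewrite invr_gt0 ltr0n expn_gt0.
set c := prime_count (2 ^ i).+1 (2 ^ i.+1).+1.
have cx : i%:R * (c%:R * x) <= 2.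
  have := prime_count_dyadic_le i; rewrite -/c expnS -(ler_nat R) !natrM.
  by move=> h; rewrite mulrA ler_pdivrMr ?ltr0n ?expn_gt0.
have i3' : 3 <= i%:R :> R by rewrite ler_nat.
have le1 : euler_prod_pos R (2 ^ i).+1 (2 ^ i.+1).+1 <= (1 + x) ^+ c.
  rewrite /euler_prod_pos /c /prime_count -iter_mulr_1 -big_const_seq.
  rewrite big_seq_cond [leRHS]big_seq_cond; apply: ler_prod => p.
  rewrite mem_index_iota => /andP[/andP[p1 _] pp].
  rewrite addr_ge0 ?invnat_ge0 ?ler01 //= lerD2l lef_pV2 ?posrE ?ltr0n ?expn_gt0 ?prime_gt0 //.
  by rewrite ler_nat ltnW.
have c1 : c%:R * x < 1 by nra.
have := exp1D_le (ltW x0) c1.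
have := euler_prod_pos_ge1 (2 ^ i).+1 (2 ^ i.+1).+1.
set P := euler_prod_pos _ _ _ in le1 *; move=> P1.
set y := (1 + x) ^+ c in le1 *; set u := c%:R * x in cx c1 *.
move=> h.
have h2 : P * (1 - u) <= 1 by apply: le_trans h; apply: ler_wpM2r => //; lra.
have : i%:R * (P * (1 - u)) <= i%:R by rewrite -[leRHS]mulr1 ler_wpM2l.
nra.
Qed.

Lemma euler_prod_pos_le i : (3 <= i)%N -> euler_prod_pos R 0 (2 ^ i).+1 <= 3 * i%:R ^+ 2.
Proof.
move=> i3; suff : euler_prod_pos R 0 (2 ^ i).+1 <= 3 * (i%:R - 1) * (i%:R - 2).
  have : 3 <= i%:R :> R by rewrite ler_nat.
  by nra.
rewrite -(subnK i3); elim: (i - 3)%N => [|j IH].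
  by rewrite /euler_prod_pos unlock /=; lra.
rewrite addSn; set m := (j + 3)%N in IH *.
have m3 : 3 <= m%:R :> R by rewrite ler_nat leq_addl.
rewrite (@euler_prod_pos_cat _ (2 ^ m).+1) // ?ltnS ?leq_exp2l //.
have := @euler_prod_pos_dyadic m (leq_addl _ _).
have := euler_prod_pos_ge1 (2 ^ m).+1 (2 ^ m.+1).+1.
move: IH; rewrite -natr1.
set A := euler_prod_pos _ _ _; set B := euler_prod_pos _ _ _.
move=> IH B1 hB.
apply: le_trans (_ : 3 * (m%:R - 1) * (m%:R - 2) * B <= _); first by apply: ler_wpM2r => //; lra.
nra.
Qed.

Lemma euler_prod_interval i J : (3 <= i)%N -> (i <= J)%N ->
  J%:R * euler_prod R (2 ^ i).+1 (2 ^ J).+1 <= 18 * i%:R ^+ 4.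
Proof.
move=> i3 iJ; have := mertens_upper J.
rewrite (@euler_prod_cat _ (2 ^ i).+1) // ?ltnS ?leq_exp2l //.
have := euler_prod_inv (2 ^ i).+1; have := euler_prod_pos_le i3.
have := euler_prod_ge0 0 (2 ^ i).+1; have := euler_prod_ge0 (2 ^ i).+1 (2 ^ J).+1.
have := euler_prod_pos_ge1 0 (2 ^ i).+1.
set A := euler_prod _ _ _; set B := euler_prod _ _ _; set V := euler_prod_pos _ _ _.
move=> V1 A0 B0 Vi BV JBA.
have J0 : 0 <= J%:R :> R by [].
have V2 : V ^+ 2 <= 9 * i%:R ^+ 4.
  have -> : 9 * i%:R ^+ 4 = (3 * i%:R ^+ 2) ^+ 2 :> R by ring.
  by rewrite ler_pXn2r // nnegrE; lra.
have : J%:R * A <= J%:R * A * (B * V ^+ 2).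
  by rewrite -[leLHS]mulr1; apply: ler_wpM2l => //; apply: mulr_ge0.
have : J%:R / 2 * (B * A) * V ^+ 2 <= 1 * V ^+ 2.
  by apply: ler_wpM2r => //; rewrite exprn_ge0 //; lra.
lra.
Qed.
End Mertens.

(** * Brun's pure sieve *)

Section Sieve.
Variable R : realFieldType.

(* Truncation of [\prod_(p <- ps) (1 - w p)] to the terms of degree at most [r] in [w]. *)
Fixpoint bonferroni (w : nat -> R) (ps : seq nat) (r : nat) : R :=
  match ps, r with
  | p :: ps', r'.+1 => bonferroni w ps' r - w p * bonferroni w ps' r'
  | _, _ => 1
  end.

Lemma bonferroni_bounds w ps r : (forall p, p \in ps -> 0 <= w p <= 1) ->
  0 <= (-1) ^+ r * (bonferroni w ps r - \prod_(p <- ps) (1 - w p))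
    <= 2^-1 ^+ r.+1 * \prod_(p <- ps) (1 + 2 * w p).
Proof.
elim: ps r => [|p ps IH] r Hw.
  have -> : bonferroni w [::] r = 1 by case: r.
  rewrite !big_nil.
  by rewrite subrr mulr0 lexx mulr1 exprn_ge0 // invr_ge0.
have Hps q : q \in ps -> 0 <= w q <= 1 by move=> qs; apply: Hw; rewrite inE qs orbT.
have /andP[w0 w1] := Hw p (mem_head _ _).
have P1 : 1 <= \prod_(p <- ps) (1 + 2 * w p).
  rewrite big_seq -[leLHS](@big1_eq _ _ *%R _ ps (fun i => i \in ps)) //.
  by apply: ler_prod => q /Hps /andP[q0 q1]; rewrite ler01 /=; lra.
have Q01 : 0 <= \prod_(p <- ps) (1 - w p) <= 1.
  rewrite big_seq; apply/andP; split.
    by apply: prodr_ge0 => q /Hps /andP[q0 q1]; lra.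
  rewrite -[leRHS](@big1_eq _ _ *%R _ ps (fun i => i \in ps)) //.
  by apply: ler_prod => q /Hps /andP[q0 q1]; apply/andP; split; lra.
rewrite !big_cons; case: r => [|r].
  have := IH 0 Hps; rewrite !expr0 !mul1r expr1.
  have -> : bonferroni w ps 0 = 1 by case: (ps).
  move: P1 Q01; set P := \prod_(p <- ps) (1 + 2 * _); set Q := \prod_(p <- ps) _.
  by move=> P1 /andP[Q0 Q1] /= /andP[_ h]; apply/andP; split; nra.
have /andP[h1 h2] := IH r Hps; have /andP[h3 h4] := IH r.+1 Hps.
move: h1 h2 h3 h4 P1 Q01; rewrite /= !exprS.
set P := \prod_(p <- ps) (1 + 2 * _); set Q := \prod_(p <- ps) _.
set A := bonferroni _ _ _; set B := bonferroni _ _ _; set s := (-1) ^+ r.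
set t := 2^-1 ^+ r.
have t0 : 0 <= t by rewrite exprn_ge0 // invr_ge0.
move=> h1 h2 h3 h4 P1 /andP[Q0 Q1].
have -> : -1 * s * (B - w p * A - (1 - w p) * Q) =
  (-1 * s * (B - Q)) + w p * (s * (A - Q)) by ring.
have h5 : w p * (s * (A - Q)) <= w p * (2^-1 * t * P) by apply: ler_wpM2l.
apply/andP; split; first by apply: addr_ge0 => //; apply: mulr_ge0.
lra.
Qed.

Lemma count_residue_nat X q b : (b < q)%N ->
  (\sum_(n < X) (n %% q == b) = X %/ q + (b < X %% q))%N.
Proof.
move=> bq; elim: X => [|X IH]; first by rewrite big_ord0 div0n mod0n.
rewrite big_ord_recr /= {}IH divnS; last by lia.
rewrite modnS; have := ltn_pmod X (d := q); have q0 : (0 < q)%N by lia.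
move=> /(_ q0); case: (boolP (q %| X.+1)%N) => [|nd].
  move=> /dvdnP[e E] xq /=.
  have E2 : (X %% q = q.-1)%N.
    case: e E => [|e] E; first by rewrite mul0n in E.
    have -> : X = (e * q + q.-1)%N by rewrite mulSn in E; lia.
    by rewrite modnMDl modn_small //; lia.
  rewrite E2; lia.
move=> xq /=; lia.
Qed.

Lemma count_residue X q a : (0 < q)%N ->
  `|\sum_(n < X | (n == a %[mod q])%N) (1 : R) - X%:R / q%:R| <= 1.
Proof.
move=> q0; have aq := ltn_pmod a q0.
have -> : \sum_(n < X | (n == a %[mod q])%N) (1 : R) =
   (\sum_(n < X) (n %% q == a %% q))%N%:R.
  by rewrite natr_sum big_mkcond; apply: eq_bigr => n _; case: eqP.
have EX : X%:R = (X %/ q)%:R * q%:R + (X %% q)%:R :> R.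
  by rewrite {1}(divn_eq X q) natrD natrM.
rewrite count_residue_nat // EX natrD mulrDl mulfK ?pnatr_eq0; last by lia.
rewrite opprD addrACA subrr add0r.
have xq := ltn_pmod X q0.
have h : 0 <= ((X %% q)%:R / q%:R : R) <= 1.
  by rewrite divr_ge0 // ler_pdivrMr ?ltr0n // mul1r ler_nat ltnW.
move: h => /andP[h1 h2].
by case: (_ < _)%N; rewrite ?mulr1n ?mulr0n ler_norml; apply/andP; split; lra.
Qed.

Definition sieve_ind (hs : seq nat) (n p : nat) : R := (has (fun h => p %| n + h)%N hs)%:R.

Lemma sieve_ind_sum hs n p : uniq hs -> (forall h, h \in hs -> h < p)%N ->
  sieve_ind hs n p = \sum_(h <- hs) (p %| n + h)%N%:R.
Proof.
rewrite /sieve_ind; elim: hs => [|h hs IH]; first by rewrite big_nil.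
move=> /= /andP[hn Hu] Hp; rewrite big_cons -IH //; last first.
  by move=> g gs; apply: Hp; rewrite inE gs orbT.
case: (boolP (p %| n + h)%N) => ph /=; last by rewrite add0r.
case: hasP => [[g gs pg]|_]; last by rewrite addr0.
have hp : (h < p)%N by apply: Hp; rewrite mem_head.
have gp : (g < p)%N by apply: Hp; rewrite inE gs orbT.
suff E : h = g by rewrite E gs in hn.
have : (n + h == n + g %[mod p])%N by move: ph pg; rewrite /dvdn => /eqP -> /eqP ->.
by rewrite eqn_modDl !modn_small // => /eqP.
Qed.

Lemma dvdn_add_mod n h p : (h < p)%N -> (p %| n + h)%N = (n == p - h %[mod p])%N.
Proof.
move=> hp; rewrite -(eqn_modDr h) subnK; last by exact: ltnW.
by rewrite modnn.
Qed.

Lemma bonferroni_sum hs ps r X q a :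
  uniq hs -> uniq ps -> all prime ps ->
  (forall p h, p \in ps -> h \in hs -> h < p)%N ->
  (0 < q)%N -> (forall p, p \in ps -> coprime q p) ->
  `| \sum_(n < X | (n == a %[mod q])%N) bonferroni (sieve_ind hs n) ps r
     - X%:R / q%:R * bonferroni (fun p => (size hs)%:R / p%:R) ps r |
  <= (1 + (size hs)%:R * (size ps)%:R) ^+ r.
Proof.
move=> Uh; set k := size hs.
have E1 s t : 1 <= (1 + k%:R * s%:R) ^+ t :> R.
  by rewrite exprn_ege1 // lerDl mulr_ge0.
elim: ps r q a => [|p ps IH] r q a.
  move=> _ _ _ q0 _; have e w : bonferroni w [::] r = 1 by case: r.
  under eq_bigr do rewrite e; rewrite e mulr1.
  by apply: le_trans (count_residue X a q0) _; apply: E1.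
move=> /= /andP[pps Ups] /andP[pp Pps] Hp q0 Cq.
case: r => [|r].
  by rewrite expr0 mulr1; exact: count_residue.
have Hps g h : g \in ps -> h \in hs -> (h < g)%N.
  by move=> gp; apply: Hp; rewrite inE gp orbT.
have Cps g : g \in ps -> coprime q g by move=> gp; apply: Cq; rewrite inE gp orbT.
have Cp : coprime q p by apply: Cq; exact: mem_head.
have p0 := prime_gt0 pp.
have h1 := IH r.+1 q a Ups Pps Hps q0 Cps.
have q'0 : (0 < q * p)%N by rewrite muln_gt0 q0.
have Cps' g : g \in ps -> coprime (q * p) g.
  move=> gp; rewrite coprimeMl Cps //= prime_coprime // dvdn_prime2 //; last exact: (allP Pps).
  by apply: contra pps => /eqP ->.
have h2 h := IH r (q * p)%N (chinese q p a (p - h)) Ups Pps Hps q'0 Cps'.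
rewrite sumrB.
have -> : \sum_(n < X | (n == a %[mod q])%N) sieve_ind hs n p * bonferroni (sieve_ind hs n) ps r
  = \sum_(h <- hs) \sum_(n < X | (n == chinese q p a (p - h) %[mod q * p])%N)
        bonferroni (sieve_ind hs n) ps r.
  under eq_bigr => n _.
    rewrite sieve_ind_sum //; last by move=> h hh; apply: Hp => //; exact: mem_head.
    rewrite mulr_suml; over.
  rewrite exchange_big /= big_seq [RHS]big_seq; apply: eq_bigr => h hh.
  rewrite big_mkcond [RHS]big_mkcond; apply: eq_bigr => n _.
  rewrite (chinese_remainder Cp) chinese_modl // chinese_modr //.
  rewrite dvdn_add_mod; last by apply: Hp => //; exact: mem_head.
  by case: (n == a %[mod q])%N => //=; case: (_ == _)%N; rewrite ?mul1r ?mul0r.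
set w := (fun p => k%:R / p%:R : R) in h1 h2 *.
set F := fun h => \sum_(n < X | (n == chinese q p a (p - h) %[mod q * p])%N)
        bonferroni (sieve_ind hs n) ps r.
set S := \sum_(n < X | _) _ in h1 *.
set Y := X%:R / (q * p)%:R * bonferroni w ps r.
have -> : S - \sum_(h <- hs) F h
   - X%:R / q%:R * (bonferroni w ps r.+1 - w p * bonferroni w ps r) =
   (S - X%:R / q%:R * bonferroni w ps r.+1) - \sum_(h <- hs) (F h - Y).
  rewrite sumrB big_const_seq count_predT -/k iter_addr_0 -mulr_natr /Y /w natrM.
  have hp : p%:R != 0 :> R by rewrite pnatr_eq0; lia.
  have hq : q%:R != 0 :> R by rewrite pnatr_eq0; lia.
  by field; rewrite hp.
apply: le_trans (ler_normB _ _) _.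
have h3 : `|\sum_(h <- hs) (F h - Y)| <= k%:R * (1 + k%:R * (size ps)%:R) ^+ r.
  apply: le_trans (ler_norm_sum _ _ _) _.
  apply: le_trans (ler_sum _ (fun h _ => h2 h)) _.
  by rewrite big_const_seq count_predT -/k iter_addr_0 -[leLHS]mulr_natl.
apply: le_trans (lerD h1 h3) _.
set e := 1 + k%:R * (size ps)%:R.
have -> : 1 + k%:R * (size ps).+1%:R = e + k%:R :> R by rewrite -natr1 /e; ring.
have e0 : 0 <= e by rewrite addr_ge0 // mulr_ge0.
rewrite exprS -mulrDl [leRHS]exprS; apply: ler_wpM2l; first by rewrite addr_ge0.
by apply: lerXn2r; rewrite ?nnegrE ?lerDl ?addr_ge0 ?mulr_ge0.
Qed.

Lemma sieve_bound hs ps r X : uniq hs -> uniq ps -> all prime ps ->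
  (forall p h, p \in ps -> h \in hs -> h < p)%N ->
  (forall p, p \in ps -> size hs <= p)%N -> ~~ odd r ->
  (count (fun n => all (fun p => all (fun h => ~~ (p %| n + h)%N) hs) ps) (iota 0 X))%:R
  <= X%:R * (\prod_(p <- ps) (1 - (size hs)%:R / p%:R)
       + 2^-1 ^+ r.+1 * \prod_(p <- ps) (1 + 2 * ((size hs)%:R / p%:R)))
     + (1 + (size hs)%:R * (size ps)%:R) ^+ r :> R.
Proof.
move=> Uh Up Pp Hp Hk r_even; set k := size hs in Hk *.
have sgn : (-1) ^+ r = 1 :> R by rewrite -signr_odd (negbTE r_even).
have h1 := @bonferroni_sum hs ps r X 1 0 Uh Up Pp Hp isT (fun p _ => coprime1n p).
have w01 p : p \in ps -> 0 <= (k%:R / p%:R : R) <= 1.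
  move=> pin; have p0 := prime_gt0 (allP Pp _ pin).
  by rewrite divr_ge0 //= ler_pdivrMr ?ltr0n // mul1r ler_nat Hk.
have /andP[_] := bonferroni_bounds r w01; rewrite sgn mul1r => h2.
apply: le_trans (_ : \sum_(n < X | (n == 0 %[mod 1])%N) bonferroni (sieve_ind hs n) ps r <= _).
  rewrite -sum1_count natr_sum /= big_mkcond /=.
  rewrite -[X in iota 0 X]subn0 -/(index_iota 0 X) big_mkord.
  rewrite [leRHS]big_mkcond /=; apply: ler_sum => n _; rewrite !modn1 eqxx.
  have i01 p : p \in ps -> 0 <= sieve_ind hs n p <= 1.
    by rewrite /sieve_ind; case: (has _ _); rewrite /= ?ler01 lexx.
  have /andP[h3 _] := bonferroni_bounds r i01.
  rewrite sgn mul1r subr_ge0 in h3; apply: le_trans h3.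
  case: ifP => [/allP H|_].
    rewrite big_seq -[leLHS](@big1_eq _ _ *%R _ ps (fun i => i \in ps)) //.
    rewrite le_eqVlt; apply/orP; left; apply/eqP; apply: eq_bigr => p pin.
    rewrite /sieve_ind (_ : has _ _ = false) ?subr0 //.
    by apply/negbTE; rewrite -all_predC; exact: H.
  by rewrite big_seq; apply: prodr_ge0 => p /i01 /andP[_]; rewrite subr_ge0.
move: h1; rewrite ler_norml => /andP[_]; rewrite lerBlDr addrC => h1.
apply: le_trans h1 _; rewrite lerD2r divr1; apply: ler_wpM2l => //.
by rewrite addrC -lerBlDr.
Qed.

Lemma ler_prodX (I : eqType) (s : seq I) (f g : I -> R) n :
  (forall i, i \in s -> 0 <= f i <= g i ^+ n) ->
  \prod_(i <- s) f i <= (\prod_(i <- s) g i) ^+ n.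
Proof. by move=> H; rewrite -prodrXl big_seq [leRHS]big_seq; apply: ler_prod. Qed.

Lemma bernoulli_sub (x : R) n : 0 <= x <= 1 -> 1 - n%:R * x <= (1 - x) ^+ n.
Proof.
move=> /andP[x0 x1]; elim: n => [|n IH]; first by rewrite mul0r subr0 expr0.
rewrite exprS; apply: le_trans (ler_wpM2l _ IH); last by lra.
have : 0 <= n%:R * (x * x) by rewrite mulr_ge0 // mulr_ge0.
rewrite -natr1; lra.
Qed.

Lemma bernoulli_add (x : R) n : 0 <= x -> 1 + n%:R * x <= (1 + x) ^+ n.
Proof.
move=> x0; elim: n => [|n IH]; first by rewrite mul0r addr0 expr0.
rewrite exprS; apply: le_trans (ler_wpM2l _ IH); last by lra.
have : 0 <= n%:R * (x * x) by rewrite mulr_ge0 // mulr_ge0.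
rewrite -natr1; lra.
Qed.

(* Since [h <= 2 ^ i] for all shifts, the primes above [2 ^ i] see distinct residues. *)
Lemma prime_tuple_bound hs i J r X : uniq hs -> (3 <= i)%N -> (i <= J)%N ->
  (forall h, h \in hs -> h <= 2 ^ i)%N -> (size hs <= 2 ^ i)%N -> ~~ odd r ->
  (count (fun n => (2 ^ J < n)%N && all (fun h => prime (n + h)) hs) (iota 0 X))%:R
  <= X%:R * ((18 * i%:R ^+ 4 / J%:R) ^+ size hs
             + 2^-1 ^+ r.+1 * (3 * J%:R ^+ 2) ^+ (2 * size hs))
     + (1 + (size hs)%:R * (2 ^ J)%:R) ^+ r :> R.
Proof.
move=> Uh i3 iJ Hh Hk r_even.
pose ps := [seq p <- index_iota (2 ^ i).+1 (2 ^ J).+1 | prime p].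
have Hps p : p \in ps -> [/\ prime p, 2 ^ i < p & p <= 2 ^ J]%N.
  by rewrite mem_filter mem_index_iota => /and3P[-> -> ].
have sz : (size ps <= 2 ^ J)%N.
  rewrite size_filter; apply: leq_trans (count_size _ _) _.
  by rewrite size_iota; lia.
have := @sieve_bound hs ps r X Uh.
have Ups : uniq ps by rewrite filter_uniq // iota_uniq.
move=> /(_ Ups (filter_all _ _)).
have H1 p h : p \in ps -> h \in hs -> (h < p)%N.
  by move=> /Hps[_ ip _] /Hh hi; exact: leq_ltn_trans hi ip.
have H2 p : p \in ps -> (size hs <= p)%N.
  by move=> /Hps[_ ip _]; apply: leq_trans Hk (ltnW ip).
move=> /(_ H1 H2 r_even); set k := size hs in Hk H2 *.
have J0 : 0 < J%:R :> R by rewrite ltr0n; lia.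
set A := \prod_(p <- ps) _; set B := \prod_(p <- ps) _ => h.
have hA : A <= (18 * i%:R ^+ 4 / J%:R) ^+ k.
  apply: le_trans (_ : euler_prod R (2 ^ i).+1 (2 ^ J).+1 ^+ k <= _).
    rewrite /euler_prod -big_filter -/ps; apply: ler_prodX => p pin.
    have [pp ip _] := Hps _ pin; have p0 := prime_gt0 pp.
    apply/andP; split.
      by rewrite subr_ge0 ler_pdivrMr ?ltr0n // mul1r ler_nat H2.
    apply: bernoulli_sub; rewrite invnat_ge0 invf_le1 ?ltr0n ?ler1n //.
  apply: lerXn2r; rewrite ?nnegrE ?euler_prod_ge0 ?divr_ge0 ?mulr_ge0 ?exprn_ge0 //.
  by rewrite ler_pdivlMr // mulrC; exact: euler_prod_interval.
have hB : B <= (3 * J%:R ^+ 2) ^+ (2 * k).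
  apply: le_trans (_ : euler_prod_pos R (2 ^ i).+1 (2 ^ J).+1 ^+ (2 * k) <= _).
    rewrite /euler_prod_pos -big_filter -/ps; apply: ler_prodX => p pin.
    rewrite addr_ge0 ?mulr_ge0 ?invnat_ge0 //= mulrA -natrM.
    exact: bernoulli_add (invnat_ge0 _ _).
  have P0 a b : 0 <= euler_prod_pos R a b by apply: le_trans (euler_prod_pos_ge1 R a b).
  apply: lerXn2r; rewrite ?nnegrE ?mulr_ge0 ?exprn_ge0 //.
  apply: le_trans (euler_prod_pos_le R (leq_trans i3 iJ)).
  rewrite (@euler_prod_pos_cat R 0 (2 ^ i).+1 (2 ^ J).+1) ?ltnS ?leq_exp2l //.
  by apply: ler_peMl => //; exact: euler_prod_pos_ge1.
have hE : (1 + k%:R * (size ps)%:R) ^+ r <= (1 + k%:R * (2 ^ J)%:R) ^+ r :> R.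
  apply: lerXn2r; rewrite ?nnegrE ?addr_ge0 ?mulr_ge0 //.
  by rewrite lerD2l; apply: ler_wpM2l => //; rewrite ler_nat.
apply: le_trans (_ : (count (fun n => all (fun p => all (fun h => ~~ (p %| n + h)%N) hs) ps) (iota 0 X))%:R <= _).
  rewrite ler_nat; apply: sub_count => n /andP[nJ /allP Hn].
  apply/allP => p /Hps[pp _ pJ]; apply/allP => h' hin.
  rewrite dvdn_prime2 //; last exact: Hn.
  by apply/eqP => e; move: pJ; rewrite e; lia.
apply: le_trans h _; apply: lerD => //; apply: ler_wpM2l => //.
by apply: lerD => //; apply: ler_wpM2l => //; rewrite exprn_ge0 // invr_ge0.
Qed.
End Sieve.

(** * Consecutive primes without small linear relations *)

Section Relations.
Variables (n D H : nat).

(* ['I_7] encodes the coefficients [-3, ..., 3], shifted by 3. *)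
Definition relation_value (c : {ffun 'I_n.+1 -> 'I_7}) (d : {ffun 'I_n.+1 -> 'I_D.+1}) : int :=
  \sum_i ((c i : nat)%:Z - 3) * (d i : nat)%:Z.

Definition dependent_gaps : {set {ffun 'I_n.+1 -> 'I_D.+1}} :=
  [set d | [exists c : {ffun 'I_n.+1 -> 'I_7}, [exists j, (c j != 3 :> nat)] && (`|relation_value c d| < H%:Z)]].

Lemma card_relation_level (c : {ffun 'I_n.+1 -> 'I_7}) (j : 'I_n.+1) (h : int) : c j != 3 :> nat ->
  (#|[set d | relation_value c d == h]| <= D.+1 ^ n)%N.
Proof.
move=> cj.
pose g (d : {ffun 'I_n.+1 -> 'I_D.+1}) := [ffun i : 'I_n => d (lift j i)].
have -> : (D.+1 ^ n = #|{ffun 'I_n -> 'I_D.+1}|)%N by rewrite card_ffun !card_ord.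
rewrite -(card_in_imset (f := g)); first exact: max_card.
move=> d d'; rewrite !inE => /eqP e /eqP e' gE.
have L i : d (lift j i) = d' (lift j i).
  by have := congr1 (fun f : {ffun _} => f i) gE; rewrite !ffunE.
move: e'; rewrite -e /relation_value !(bigD1_ord j) //=.
under eq_bigr do rewrite -L.
move/addIr/(mulfI _) => E.
apply/ffunP => i; case: (unliftP j i) => [i' ->|->]; first exact: L.
apply/val_inj/esym; have := E; move: cj; set a := (c j : nat); move=> aj F.
by have [] : (d' j : nat)%:Z = d j by apply: F; lia.
Qed.

Lemma card_bigcup_le (I J : finType) (F : I -> {set J}) m :
  (forall i, #|F i| <= m)%N -> (#|\bigcup_i F i| <= #|I| * m)%N.
Proof.
move=> Hm; apply: (@leq_trans (\sum_i #|F i|)%N); last first.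
  by rewrite -sum_nat_const; apply: leq_sum => i _; exact: Hm.
elim/big_rec2: _ => [|i s A _ IH]; first by rewrite cards0.
by apply: leq_trans (leq_card_setU _ _).1 _; rewrite leq_add2l.
Qed.

Lemma card_dependent_gaps :
  (#|dependent_gaps| <= 7 ^ n.+1 * n.+1 * H.*2.+1 * D.+1 ^ n)%N.
Proof.
pose T := ({ffun 'I_n.+1 -> 'I_7} * 'I_n.+1 * 'I_H.*2.+1)%type.
pose F (t : T) := if t.1.1 t.1.2 != 3 :> nat then
   [set d | relation_value t.1.1 d == t.2%:Z - H%:Z] else finset.set0.
have -> : (7 ^ n.+1 * n.+1 * H.*2.+1 = #|{: T}|)%N.
  by rewrite !card_prod card_ffun !card_ord.
apply: leq_trans (_ : #|\bigcup_t F t| <= _)%N; last first.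
  apply: card_bigcup_le => t; rewrite /F; case: ifP => [tj|_]; last by rewrite cards0.
  exact: card_relation_level tj.
apply/subset_leq_card/fintype.subsetP => d; rewrite inE => /existsP[c /andP[/existsP[j cj] vH]].
have hh : (absz (relation_value c d + H%:Z)%R < H.*2.+1)%N by lia.
apply/bigcupP; exists (c, j, Ordinal hh) => //.
rewrite /F /= cj inE; apply/eqP; lia.
Qed.
End Relations.

Lemma small_combination_gaps n (H D p : nat) (d : 'I_n.+1 -> nat) (c : 'I_n.+2 -> int) :
  (H + 3 * n.+2 * D < p)%N -> (forall i, d i <= D)%N ->
  (forall i, `|c i| <= 3) -> (exists i, c i != 0) ->
  `|c ord0 * p%:Z + \sum_i c (lift ord0 i) * (p + d i)%:Z| < H%:Z ->
  (exists i, c (lift ord0 i) != 0) /\ `|\sum_i c (lift ord0 i) * (d i)%:Z| < H%:Z.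
Proof.
move=> Hp Hd Hc [i0 ci0].
set W := \sum_i c (lift ord0 i) * (d i)%:Z.
have -> : c ord0 * p%:Z + \sum_i c (lift ord0 i) * (p + d i)%:Z =
  (c ord0 + \sum_i c (lift ord0 i)) * p%:Z + W.
  rewrite mulrDl mulr_suml -addrA -big_split /=; congr (_ + _).
  by apply: eq_bigr => i _; rewrite PoszD mulrDr.
set s := c ord0 + _ => hs.
have hW : `|W| <= (3 * n.+1 * D)%N%:Z.
  apply: le_trans (ler_norm_sum _ _ _) _.
  apply: le_trans (_ : \sum_(i < n.+1) (3 * D)%N%:Z <= _).
    apply: ler_sum => i _; rewrite normrM PoszM; apply: ler_pM => //.
    by have := Hd i; lia.
  by rewrite sumr_const card_ord; lia.
have s0 : s = 0.
  apply/eqP/negP => /negP sn.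
  have : p%:Z <= `|s * p%:Z| by rewrite normrM; nia.
  have : (3 * n.+1 * D <= 3 * n.+2 * D)%N by nia.
  move: hs hW Hp; set b := (3 * n.+1 * D)%N; set b' := (3 * n.+2 * D)%N.
  set S := s * _; lia.
split; last by move: hs; rewrite s0 mul0r add0r.
case: (unliftP ord0 i0) ci0 => [i -> ci|-> c0]; first by exists i.
apply/existsP; apply: contraT => /existsPn h.
move: s0 c0; rewrite /s big1 ?addr0 => [-> //|i _].
by apply/eqP; have := h i; rewrite negbK.
Qed.

Lemma int_abs_lt3 (z : int) : `|z| <= 3 -> {x : 'I_7 | (x : nat)%:Z - 3 = z}.
Proof.
move=> hz; have h7 : (absz (z + 3)%R < 7)%N by lia.
by exists (Ordinal h7) => /=; lia.
Qed.

Lemma exists_independent_primes_of_bound (R : realFieldType) (n H i J L r : nat) :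
  (3 <= i)%N -> (i <= J)%N -> (n.+2 <= 2 ^ i)%N -> ~~ odd r ->
  (7 ^ n.+1 * n.+1 * H.*2.+1 * (2 ^ i).+1 ^ n)%N%:R *
    ((2 ^ L).+1%:R * ((18 * i%:R ^+ 4 / J%:R) ^+ n.+2
             + 2^-1 ^+ r.+1 * (3 * J%:R ^+ 2) ^+ (2 * n.+2))
     + (1 + n.+2%:R * (2 ^ J)%:R) ^+ r)
  + (n.+1 * ((2 ^ L).+1 %/ 2 ^ i).+1 + (2 ^ J + H + 3 * n.+2 * 2 ^ i).+1)%N%:R
    < (prime_count 0 (2 ^ L).+1)%:R :> R ->
  exists m, forall c : 'I_n.+2 -> int, (forall i, `|c i| <= 3) -> (exists i, c i != 0) ->
    H%:Z <= `|\sum_i c i * (nth_prime (m + i.+1))%:Z|.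
Proof.
move=> i3 iJ ki r_even; set D := (2 ^ i)%N; set Y := (2 ^ J + H + 3 * n.+2 * D)%N.
set X := (2 ^ L).+1; set U := (X in _%:R * X) => hnum.
apply: contrapT => /forallNP hrel.
pose gaps (d : {ffun 'I_n.+1 -> 'I_D.+1}) := 0%N :: [seq val (d j) | j <- enum 'I_n.+1].
pose S := [set d in dependent_gaps n D H | uniq (gaps d)].
pose P p := [&& prime p, (Y < p)%N & (n.+1 <= prime_count p.+1 (p + D).+1)%N].
pose Q (d : {ffun 'I_n.+1 -> 'I_D.+1}) p := (2 ^ J < p)%N && all (fun h => prime (p + h)) (gaps d).
have cntP : (count P (iota 0 X) <= \sum_(d in S) count (Q d) (iota 0 X))%N.
  apply: count_le_sum_count => p _ /and3P[pp Yp Dp].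
  set m := prime_count 0 p.+1.
  have pm : nth_prime m = p by exact: nth_prime_count.
  have m0 : (0 < m)%N by exact: leq_ltn_trans (prime_count_ltn pp (prime_gt0 pp)).
  have lo (j : nat) : (p < nth_prime (m + j.+1))%N.
    by rewrite -{1}pm; apply: nth_prime_homo; rewrite -addSnnS leq_addr.
  have hi (j : 'I_n.+1) : (nth_prime (m + j.+1) <= p + D)%N.
    by apply: nth_prime_window => //; apply: leq_trans Dp.
  have dlt (j : 'I_n.+1) : (nth_prime (m + j.+1) - p < D.+1)%N.
    by have := hi j; lia.
  pose d : {ffun 'I_n.+1 -> 'I_D.+1} := [ffun j => Ordinal (dlt j)].
  have dE j : (p + d j = nth_prime (m + j.+1))%N.
    by rewrite ffunE /=; have := lo j; lia.
  exists d.
    rewrite inE; apply/andP; split; last first.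
      rewrite /= map_inj_in_uniq ?enum_uniq ?andbT; last first.
        move=> a b _ _ /= e; apply/val_inj => /=.
        have := can_inj prime_count_nth_prime; move=> /(_ (m + a.+1)%N (m + b.+1)%N).
        by rewrite -!dE e => /(_ erefl); lia.
      apply/negP => /mapP[j _ e]; have := dE j; rewrite -e addn0; have := lo j; lia.
    have /existsNP[c /not_implyP[c3 /not_implyP[c0 /negP]]] := hrel m.-1.
    rewrite -ltNge big_ord_recl /= (_ : m.-1 + 1 = m)%N ?pm; last by lia.
    have -> : \sum_(i0 < n.+1) c (lift ord0 i0) * (nth_prime (m.-1 + (bump 0 i0).+1))%:Z
      = \sum_(j < n.+1) c (lift ord0 j) * (p + d j)%N%:Z.
      by apply: eq_bigr => j _; rewrite dE /bump /=; congr (_ * (nth_prime _)%:Z); lia.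
    have dD j : (d j <= D)%N by rewrite -ltnS.
    have Yp' : (H + 3 * n.+2 * D < p)%N by move: Yp; rewrite /Y; lia.
    move=> hs; have [[j cj] vH] := small_combination_gaps Yp' dD c3 c0 hs.
    pose e j := sval (int_abs_lt3 (c3 (lift ord0 j))).
    have eE j' : (e j' : nat)%:Z - 3 = c (lift ord0 j') by exact: (svalP (int_abs_lt3 _)).
    rewrite inE; apply/existsP; exists (finfun e); apply/andP; split.
      by apply/existsP; exists j; rewrite ffunE; have := eE j; move: cj; set z := c _; lia.
    rewrite /relation_value; under eq_bigr do rewrite ffunE eE.
    exact: vH.
  rewrite /Q /=; apply/and3P; split; first by move: Yp; rewrite /Y; lia.
    by rewrite addn0.
  apply/allP => h /mapP[j _ ->]; rewrite dE addnS; exact: prime_nth_prime.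
have cnt_lower : (prime_count 0 X <= count P (iota 0 X) + (n.+1 * (X %/ D).+1 + Y.+1))%N.
  have D0 : (0 < D)%N by rewrite expn_gt0.
  have := count_isolated n.+1 X D0.
  have : (count (fun p => p <= Y)%N (iota 0 X) <= Y.+1)%N.
    rewrite -size_filter -(size_iota 0 Y.+1); apply: uniq_leq_size.
      by rewrite filter_uniq ?iota_uniq.
    by move=> p; rewrite mem_filter !mem_iota; lia.
  rewrite /prime_count /index_iota subn0.
  have : (count prime (iota 0 X) <= count P (iota 0 X) +
      (count (isolated_prime n.+1 D) (iota 0 X) + count (fun p => p <= Y)%N (iota 0 X)))%N.
    elim: (iota 0 X) => //= p s IH.
    suff : (prime p <= P p + (isolated_prime n.+1 D p + (p <= Y)))%N by lia.
    rewrite /P /isolated_prime; case: (prime p) => //=.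
    by case: (ltnP Y p) => /=; case: (ltnP _ n.+1) => //=.
  lia.
have U0 : 0 <= U by apply: addr_ge0 => //; apply: mulr_ge0.
have sumU : (\sum_(d in S) count (Q d) (iota 0 X))%:R <= #|S|%:R * U.
  rewrite natr_sum -[#|S|]sum1_card natr_sum mulr_suml; apply: ler_sum => d.
  rewrite inE mul1r => /andP[_ Ud].
  have sz : size (gaps d) = n.+2 by rewrite /= size_map size_enum_ord.
  rewrite /U -sz; apply: prime_tuple_bound => //; last by rewrite sz.
  move=> h; rewrite inE => /orP[/eqP -> //|/mapP[j _ ->]].
  by rewrite -ltnS ltn_ord.
have cS : (#|S| <= 7 ^ n.+1 * n.+1 * H.*2.+1 * D.+1 ^ n)%N.
  apply: leq_trans (card_dependent_gaps n D H).
  by apply/subset_leq_card/fintype.subsetP => d; rewrite inE => /andP[].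
have : (prime_count 0 X)%:R <= #|S|%:R * U + (n.+1 * (X %/ D).+1 + Y.+1)%N%:R.
  apply: le_trans (_ : (count P (iota 0 X) + (n.+1 * (X %/ D).+1 + Y.+1))%N%:R <= _).
    by rewrite ler_nat.
  rewrite natrD lerD2r; apply: le_trans sumU; by rewrite ler_nat.
have : #|S|%:R * U <= (7 ^ n.+1 * n.+1 * H.*2.+1 * D.+1 ^ n)%N%:R * U.
  by apply: ler_wpM2r => //; rewrite ler_nat.
move=> a b; move: hnum; apply/negP; rewrite -leNgt.
by apply: le_trans b _; rewrite lerD2r.
Qed.

Lemma exists_independent_primes (n H : nat) :
  exists m, forall c : 'I_n.+2 -> int, (forall i, `|c i| <= 3) -> (exists i, c i != 0) ->
    H%:Z <= `|\sum_i c i * (nth_prime (m + i.+1))%:Z|.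
Proof.
have [R _] : exists R : realFieldType, True by exists rat.
have [i [J [L [r []]]]] := sieve_parameters n H.
set M := (7 ^ n.+1 * n.+1 * H.*2.+1 * (2 ^ i).+1 ^ n)%N.
move=> /and5P[i3 iJ ki r_even L0] ha hb hc /andP[hd he].
have hp := prime_count_pow2_ge L0.
apply: (@exists_independent_primes_of_bound R n H i J L r) => //.
move: ha hb hc hd he hp; rewrite -/M; set Y := (_ + _ + _).+1.
set p := prime_count _ _.
rewrite -!(ler_nat R); move: M Y p => M Y p.
have [k kE] : exists k, k = n.+2 by exists n.+2.
rewrite -kE !(natrX, natrM, natrD) -mul2n natrM; clear kE.
set A := (18 * i%:R ^+ 4 / J%:R) ^+ k; set B := 2^-1 ^+ r.+1 * _; set C := _ ^+ r.
move=> ha hb hc hd he hp.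
have J0 : 0 < J%:R :> R by rewrite ltr0n; lia.
have {}ha : 32 * L%:R * M%:R * A <= 1.
  by rewrite /A expr_div_n mulrA ler_pdivrMr ?exprn_gt0 // mul1r.
have {}hb : 32 * L%:R * M%:R * B <= 1.
  rewrite /B exprVn mulrCA mulrC ler_pdivrMr ?exprn_gt0 // mul1r.
  exact: hb.
have hdiv : (((2 ^ L).+1 %/ 2 ^ i)%N%:R : R) * 2 ^+ i <= 2 ^+ L + 1.
  by rewrite -!natrX -natrM natr1 ler_nat leq_divM.
set Q := ((2 ^ L).+1 %/ 2 ^ i)%N in hdiv *.
rewrite -natr1 natrX -[Q.+1%:R]natr1.
have L1 : 1 <= L%:R :> R by rewrite ler1n.
have x1 : 1 <= 2 ^+ L :> R by rewrite exprn_ege1 // ler1n.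
set x := 2 ^+ L in hc hdiv he hp x1 *; set D := 2 ^+ i in hd hdiv.
have hQ : 32 * n.+1%:R * L%:R * Q%:R <= x + 1.
  by apply: le_trans hdiv; rewrite [leRHS]mulrC; apply: ler_wpM2r.
rewrite -(@ltr_pM2l _ (32 * L%:R)); last by rewrite mulr_gt0 // ltr0n.
have : 32 * L%:R * M%:R * A * (x + 1) <= 1 * (x + 1) by apply: ler_wpM2r => //; lra.
have : 32 * L%:R * M%:R * B * (x + 1) <= 1 * (x + 1) by apply: ler_wpM2r => //; lra.
lra.
Qed.

(** * Riesz products *)

Section Riesz.
Variable R : realType.

Definition cosf (s : int) (x : R) : R := cos (2 * pi * s%:~R * x).

(* [v] approximates the integral of [F] over [[a, b]] with error at most [e]. *)
Definition integral_near (a b : R) (F : R -> R) (v e : R) : Prop :=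
  exists2 G : R -> R, (forall x : R, is_derive x 1 G (F x)) & `|G b - G a - v| <= e.

Variables a b : R.
Local Notation near := (integral_near a b).

Lemma near_ext F F' v e : F =1 F' -> near F v e -> near F' v e.
Proof. by move=> FE [G dG hG]; exists G => // x; rewrite -FE. Qed.

Lemma near_le F v e e' : e <= e' -> near F v e -> near F v e'.
Proof. by move=> ee [G dG hG]; exists G => //; apply: le_trans ee. Qed.

Lemma near_cst c : near (fun=> c) (c * (b - a)) 0.
Proof.
exists (fun x => c * x).
  move=> x; have := @is_deriveZ _ _ _ (@id R) c x 1 1 (is_derive_id x 1).
  rewrite /GRing.scale /= mulr1; exact.
by rewrite -mulrBr subrr normr0.
Qed.

Lemma nearD F F' v v' e e' : near F v e -> near F' v' e' ->
  near (fun x => F x + F' x) (v + v') (e + e').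
Proof.
move=> [G dG hG] [G' dG' hG']; exists (fun x => G x + G' x).
  by move=> x; apply: is_deriveD.
have -> : G b + G' b - (G a + G' a) - (v + v') = (G b - G a - v) + (G' b - G' a - v') by ring.
by apply: le_trans (ler_normD _ _) _; apply: lerD.
Qed.

Lemma nearZ c F v e : near F v e -> near (fun x => c * F x) (c * v) (`|c| * e).
Proof.
move=> [G dG hG]; exists (fun x => c * G x).
  by move=> x; apply: is_deriveZ.
have -> : c * G b - c * G a - c * v = c * (G b - G a - v) by ring.
by rewrite normrM; apply: ler_wpM2l.
Qed.

Lemma near_sum (I : Type) (s : seq I) (F : I -> R -> R) v e :
  (forall i, near (F i) v e) ->
  near (fun x => \sum_(i <- s) F i x) ((size s)%:R * v) ((size s)%:R * e).
Proof.
move=> H; elim: s => [|i s IH].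
  have := near_cst 0; rewrite !mul0r; apply: near_ext => x; by rewrite big_nil.
have := nearD (H i) IH; rewrite /= -[(size s).+1%:R]natr1 !mulrDl !mul1r.
rewrite [v + _]addrC [e + _]addrC; apply: near_ext => x; by rewrite big_cons.
Qed.

Lemma near_cosf (H : nat) (s : int) : (0 < H)%N -> H%:Z <= `|s| -> near (cosf s) 0 (H%:R^-1).
Proof.
move=> H0 Hs; set w : R := 2 * pi * s%:~R.
have pi1 : 2 <= pi :> R by exact: pi_ge2.
have s0 : s != 0 by apply: contraTneq Hs => ->; rewrite normr0; lia.
have hw : 2 * H%:R <= `|w|.
  rewrite /w !normrM [`|2|]ger0_norm // [`|pi|]ger0_norm; last by lra.
  have : H%:R <= `|s%:~R : R|.
    by rewrite -intr_norm -[H%:R]/(H%:Z%:~R) ler_int.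
  have : 0 <= H%:R :> R by [].
  nra.
have H0' : 0 < H%:R :> R by rewrite ltr0n.
have w0 : w != 0 by rewrite -normr_gt0; lra.
exists (fun x => w^-1 * sin (w * x)).
  move=> x; rewrite /cosf -/w.
  have d1 : is_derive x 1 (fun x => w * x) w.
    have := @is_deriveZ _ _ _ (@id R) w x 1 1 (is_derive_id x 1).
    by rewrite /GRing.scale /= mulr1.
  have d2 := @is_derive1_comp _ sin (fun x => w * x) x _ _ (is_derive_sin _) d1.
  have := @is_deriveZ _ _ _ _ w^-1 x 1 _ d2.
  by rewrite /GRing.scale /= mulrCA mulVf // mulr1.
rewrite subr0 -mulrBr normrM normfV.
have h : `|sin (w * b) - sin (w * a)| <= 2.
  apply: le_trans (ler_normB _ _) _.
  have hs (y : R) : `|sin y| <= 1 by rewrite ler_norml sin_geN1 sin_le1.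
  by have := hs (w * b); have := hs (w * a); lra.
rewrite ler_pdivrMl ?normr_gt0 //; apply: le_trans h _.
by rewrite ler_pdivlMr.
Qed.

Lemma cosfD s t x : cosf s x * cosf t x = 2^-1 * cosf (s + t) x + 2^-1 * cosf (s - t) x.
Proof.
rewrite /cosf; set u := 2 * pi * s%:~R * x; set v := 2 * pi * t%:~R * x.
have -> : 2 * pi * (s + t)%:~R * x = u + v by rewrite /u /v intrD; ring.
have -> : 2 * pi * (s - t)%:~R * x = u - v by rewrite /u /v intrB; ring.
by rewrite cosB cosD; field.
Qed.

Section Product.
Variables (I : eqType) (q : I -> int) (H : nat).
Hypothesis H0 : (0 < H)%N.

Definition riesz (A : seq I) (x : R) : R := \prod_(i <- A) (1 + cosf (q i) x).

Fixpoint dissociated (s : int) (A : seq I) : Prop :=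
  match A with
  | [::] => H%:Z <= `|s|
  | i :: A' => [/\ dissociated s A', dissociated (s + q i) A' & dissociated (s - q i) A']
  end.

Lemma near_cosf_riesz s A : dissociated s A ->
  near (fun x => cosf s x * riesz A x) 0 (2 ^+ size A / H%:R).
Proof.
elim: A s => [|i A IH] s /=.
  move=> Hs; rewrite mul1r; apply: near_ext (near_cosf H0 Hs) => x.
  by rewrite /riesz big_nil mulr1.
move=> [/IH h1 /IH h2 /IH h3].
have := nearD (nearD h1 (nearZ 2^-1 h2)) (nearZ 2^-1 h3).
rewrite !mulr0 !addr0 ger0_norm ?invr_ge0 //.
set e := 2 ^+ size A / H%:R.
have -> : e + 2^-1 * e + 2^-1 * e = 2 ^+ (size A).+1 / H%:R by rewrite exprS -mulrA -/e; field.
apply: near_ext => x; rewrite /riesz big_cons.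
transitivity ((cosf s x + cosf s x * cosf (q i) x) * \prod_(j <- A) (1 + cosf (q j) x)).
  by rewrite cosfD; ring.
ring.
Qed.

Lemma near_riesz A :
  (forall i B, subseq (i :: B) A -> dissociated (q i) B) ->
  near (riesz A) (b - a) ((size A)%:R * 2 ^+ size A / H%:R).
Proof.
elim: A => [|i A IH] HA.
  rewrite !mul0r; have := near_cst 1; rewrite mul1r; apply: near_ext => x.
  by rewrite /riesz big_nil.
have hA : forall j B, subseq (j :: B) A -> dissociated (q j) B.
  by move=> j B jB; apply: HA; apply: subseq_trans jB (subseq_cons _ _).
have hi : dissociated (q i) A by apply: HA.
have := nearD (IH hA) (near_cosf_riesz hi); rewrite addr0.
move=> h; apply: near_ext (near_le _ h).
  by move=> x; rewrite /riesz big_cons mulrDl mul1r.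
rewrite -mulrDl ler_pM2r ?invr_gt0 ?ltr0n // /= exprS -natr1.
have : 0 <= 2 ^+ size A :> R by rewrite exprn_ge0.
have : 0 <= (size A)%:R :> R by [].
set u := _%:R; set v := 2 ^+ _; nra.
Qed.

(* With [C j = cos (j * t)]: (1 - C 1)^2 (1 + C 1) = 1/2 - C 1 / 4 - C 2 / 2 + C 3 / 4. *)
Lemma near_sq_riesz i A :
  (forall i B, subseq (i :: B) A -> dissociated (q i) B) ->
  dissociated (q i) A -> dissociated (2 * q i) A -> dissociated (3 * q i) A ->
  near (fun x => (1 - cosf (q i) x) ^+ 2 * ((1 + cosf (q i) x) * riesz A x))
    (2^-1 * (b - a)) ((size A).+1%:R * 2 ^+ size A / H%:R).
Proof.
move=> hA h1 h2 h3.
have := nearD (nearD (nearD (nearZ 2^-1 (near_riesz hA)) (nearZ (- 4^-1) (near_cosf_riesz h1)))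
  (nearZ (- 2^-1) (near_cosf_riesz h2))) (nearZ 4^-1 (near_cosf_riesz h3)).
rewrite !mulr0 !addr0 !normrN ![ `|_^-1| ]ger0_norm ?invr_ge0 // => h.
apply: near_ext (near_le _ h).
  move=> x; rewrite /cosf; set t := 2 * pi * (q i)%:~R * x.
  have -> : 2 * pi * (2 * q i)%:~R * x = t *+ 2 by rewrite /t intrM mulr2n; ring.
  have -> : 2 * pi * (3 * q i)%:~R * x = t *+ 2 + t by rewrite /t intrM mulr2n; ring.
  rewrite [cos (t *+ 2 + t)]cosD cos_mulr2n sin_mulr2n.
  have := cos2Dsin2 t; set c := cos t; set s := sin t; move=> cs.
  have hs : s ^+ 2 = 1 - c ^+ 2 by lra.
  have -> : c * s *+ 2 * s = 2 * c * s ^+ 2 by rewrite mulr2n; ring.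
  rewrite hs !mulr2n; set y := riesz A x.
  by field.
set u := 2 ^+ size A / H%:R.
have u0 : 0 <= u by rewrite divr_ge0 // exprn_ge0.
rewrite -!(mulrA _ (2 ^+ size A)) -/u -[(size A).+1%:R]natr1.
have : 0 <= (size A)%:R * u by rewrite mulr_ge0.
lra.
Qed.
End Product.
End Riesz.

Definition independent_freqs k (q : 'I_k -> int) (H : nat) : Prop :=
  forall c : 'I_k -> int, (forall i, `|c i| <= 3) -> (exists i, c i != 0) ->
    H%:Z <= `|\sum_i c i * q i|.

Lemma independent_dissociated k (q : 'I_k -> int) H (A : seq 'I_k) (c : 'I_k -> int) i0 :
  independent_freqs q H -> uniq A -> (forall i, `|c i| <= 3) ->
  (forall i, i \in A -> c i = 0) -> i0 \notin A -> c i0 != 0 ->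
  dissociated q H (\sum_i c i * q i) A.
Proof.
move=> ind; elim: A c => [|j A IH] c /=; first by move=> _ Hc _ _ ci0; apply: ind => //; exists i0.
move=> /andP[jA uA] Hc cA; rewrite inE negb_or => /andP[i0j i0A] ci0.
have cj : c j = 0 by apply: cA; rewrite mem_head.
have step (u : int) : `|u| <= 3 -> dissociated q H (\sum_i c i * q i + u * q j) A.
  move=> hu; have -> : \sum_i c i * q i + u * q j =
      \sum_i (if i == j then u else c i) * q i.
    rewrite (bigD1 j) //= [RHS](bigD1 j) //= eqxx cj mul0r add0r addrC; congr (_ + _).
    by apply: eq_bigr => i /negbTE ->.
  apply: IH => //.
  - by move=> i; case: ifP.
  - move=> i iA; case: eqP => [e|_]; first by rewrite -e iA in jA.
    by apply: cA; rewrite inE iA orbT.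
  - by rewrite (negbTE i0j).
split.
- by have := step 0; rewrite mul0r addr0; apply.
- by have := step 1; rewrite mul1r; apply.
- by have := step (-1); rewrite mulN1r; apply.
Qed.

Lemma independent_dissociated1 k (q : 'I_k -> int) H (A : seq 'I_k) i (u : int) :
  independent_freqs q H -> uniq A -> i \notin A -> u != 0 -> `|u| <= 3 ->
  dissociated q H (u * q i) A.
Proof.
move=> ind uA iA u0 u3.
have -> : u * q i = \sum_j (if j == i then u else 0) * q j.
  rewrite (bigD1 i) //= eqxx big1 ?addr0 // => j /negbTE ->; exact: mul0r.
apply: (@independent_dissociated _ q H A _ i ind uA) => //.
- by move=> j; case: ifP.
- by move=> j jA; case: eqP => // e; rewrite -e jA in iA.
- by rewrite eqxx.
Qed.

Lemma riesz_ge0 (R : realType) (I : eqType) (q : I -> int) A (x : R) : 0 <= riesz q A x.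
Proof.
by apply: prodr_ge0 => i _; have := cos_geN1 (2 * pi * (q i)%:~R * x); rewrite /cosf; lra.
Qed.

Lemma riesz_bias (R : realType) k (q : 'I_k -> int) H (a b : R) : (0 < H)%N ->
  independent_freqs q H ->
  integral_near a b (fun x => (\sum_i 4 / 9 * (1 - cosf (q i) x) ^+ 2 - k%:R / 4) * riesz q (enum 'I_k) x)
    (- (k%:R / 36) * (b - a)) (k%:R * k%:R * 2 ^+ k / H%:R).
Proof.
move=> H0 ind; set E := enum 'I_k.
have uE : uniq E by exact: enum_uniq.
have sE : size E = k by exact: size_enum_ord.
have dis i B (u : int) : uniq B -> i \notin B -> u != 0 -> `|u| <= 3 -> dissociated q H (u * q i) B.
  exact: independent_dissociated1.
have disE A : uniq A -> forall i B, subseq (i :: B) A -> dissociated q H (q i) B.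
  move=> uA i B /subseq_uniq/(_ uA) /= /andP[iB uB].
  by have := dis i B 1 uB iB; rewrite mul1r; apply.
have term (i : 'I_k) : integral_near a b (fun x => (1 - cosf (q i) x) ^+ 2 * riesz q E x)
    (2^-1 * (b - a)) (k%:R * 2 ^+ k / H%:R).
  have iE : i \in E by rewrite mem_enum.
  have uA : uniq (rem i E) by exact: rem_uniq.
  have iA : i \notin rem i E by rewrite mem_rem_uniq // inE eqxx.
  have d1 := dis i _ 1 uA iA isT isT; rewrite mul1r in d1.
  have := near_sq_riesz a b H0 (disE _ uA) d1 (dis i _ 2 uA iA isT isT) (dis i _ 3 uA iA isT isT).
  move=> h; apply: near_ext (near_le _ h).
    by move=> x; rewrite /riesz (perm_big _ (perm_to_rem iE)) /= big_cons.
  rewrite size_rem // sE prednK; last exact: leq_ltn_trans (ltn_ord i).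
  rewrite ler_pM2r ?invr_gt0 ?ltr0n //; apply: ler_wpM2l => //.
  by rewrite ler_eXn2l ?leq_pred // ltr1n.
have h1 := nearZ (4 / 9) (near_sum E term).
have h2 := nearZ (- (k%:R / 4)) (near_riesz a b H0 (disE _ uE)).
have := nearD h1 h2; rewrite sE normrN !ger0_norm ?divr_ge0 // => h.
have -> : - (k%:R / 36) * (b - a) = 4 / 9 * (k%:R * (2^-1 * (b - a))) + - (k%:R / 4) * (b - a) :> R.
  by field.
apply: near_ext (near_le _ h).
  move=> x; rewrite mulrBl mulNr; congr (_ - _).
  by rewrite -mulr_suml -mulr_sumr mulrA /E big_enum.
have -> : k%:R * k%:R * 2 ^+ k / H%:R = k%:R * (k%:R * 2 ^+ k / H%:R) :> R by rewrite !mulrA.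
set e := k%:R * 2 ^+ k / H%:R.
have : 0 <= k%:R * e by rewrite mulr_ge0 // divr_ge0 // mulr_ge0 // exprn_ge0.
lra.
Qed.

Lemma exists_biased_window (R : realType) (n : nat) (a b : R) : a < b ->
  exists x, [/\ a < x, x < b & exists m,
    \sum_(i < n.+2) 4 / 9 * (1 - cosf (nth_prime (m + i.+1))%:Z x) ^+ 2 < n.+2%:R / 4].
Proof.
move=> ab; set k := n.+2.
have ba : 0 < b - a by rewrite subr_gt0.
have [H hH] : exists H : nat, k%:R * 2 ^+ k * 36 / (b - a) < H%:R.
  exists (Num.bound (k%:R * 2 ^+ k * 36 / (b - a))); apply: archi_boundP.
  apply: divr_ge0 (ltW ba); apply: mulr_ge0 => //; apply: mulr_ge0 => //.
have k0 : 0 < k%:R :> R by rewrite ltr0n.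
have H0 : (0 < H)%N.
  rewrite -(ltr0n R); apply: le_lt_trans hH.
  by apply: divr_ge0 (ltW ba); apply: mulr_ge0 => //; apply: mulr_ge0 => //.
have [m ind] := exists_independent_primes n H.
pose q (i : 'I_k) := (nth_prime (m + i.+1))%:Z.
have [G dG hG] := riesz_bias a b H0 (ind : independent_freqs q H).
have Gneg : G b - G a < 0.
  have hlt : k%:R * k%:R * 2 ^+ k / H%:R < k%:R / 36 * (b - a).
    rewrite ltr_pdivrMr ?ltr0n //; move: hH; rewrite ltr_pdivrMr // => hH.
    by rewrite -!mulrA ltr_pM2l //; lra.
  by move: hG; rewrite ler_norml => /andP[_]; lra.
have cG : {within `[a, b], continuous G}%classic.
  apply: derivable_within_continuous => x _; exact: ex_derive.
have [x xab E] := MVT ab (fun x _ => dG x) cG.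
move: xab; rewrite in_itv /= => /andP[ax xb].
exists x; split => //; exists m.
have := riesz_ge0 q (enum 'I_k) x.
move: Gneg; rewrite E pmulr_llt0 // => h1 h2.
rewrite -subr_lt0 ltNge; apply/negP => h3.
by move: h1; rewrite ltNge mulr_ge0.
Qed.

(** * Conclusion *)

Lemma cos_pi3 (R : realType) : cos (pi / 3) = 2^-1 :> R.
Proof.
have p0 := pi_gt0 R.
set t : R := pi / 3.
have c0 : 0 < cos t by apply: cos_gt0_pihalf; rewrite /t; lra.
have : cos (t *+ 2 + t) = -1 by rewrite -cospi; congr cos; rewrite /t mulr2n; field.
rewrite cosD cos_mulr2n sin_mulr2n.
have := cos2Dsin2 t; set c := cos t in c0 *; set s := sin t; move=> cs.
have hs : s ^+ 2 = 1 - c ^+ 2 by lra.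
have -> : c * s *+ 2 * s = 2 * c * s ^+ 2 by rewrite mulr2n; ring.
rewrite hs => h.
have : (c + 1) * (2 * c - 1) ^+ 2 = 0 by lra.
move/eqP; rewrite mulf_eq0 expf_eq0 /= => /orP[/eqP|/eqP]; lra.
Qed.

Lemma cosDint (R : realType) (z : int) (y : R) : cos (y + 2 * pi * z%:~R) = cos y.
Proof.
have e (n : nat) : 2 * pi * n%:R = (pi *+ 2) *+ n :> R by rewrite -[RHS]mulr_natr -[pi *+ 2]mulr_natl.
case: z => n.
  by rewrite -pmulrn e (periodicn (@cosD2pi R)).
rewrite NegzE mulrNz mulrN -pmulrn e -[in RHS](subrK ((pi *+ 2) *+ n.+1) y).
by rewrite (periodicn (@cosD2pi R)).
Qed.

Lemma middle_third_le_cos (R : realType) (y : R) : 3^-1 <= frac_part y <= 2 / 3 ->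
  1 <= 4 / 9 * (1 - cos (2 * pi * y)) ^+ 2.
Proof.
rewrite /frac_part; set z := Num.floor y; set f := y - _ => /andP[f1 f2].
have -> : y = f + z%:~R by rewrite /f subrK.
rewrite mulrDr cosDint; have p0 := pi_gt0 R.
set t := 2 * pi * f - pi.
have -> : 2 * pi * f = t + pi by rewrite /t; ring.
rewrite cosDpi opprK.
have ht : `|t| <= pi / 3.
  have -> : t = pi * (2 * f - 1) by rewrite /t; ring.
  rewrite normrM gtr0_norm //; apply: ler_wpM2l; first exact: ltW.
  by rewrite ler_norml; apply/andP; split; lra.
have -> : cos t = cos `|t| by case: (ger0P t) => // _; rewrite cosN.
have hc : 2^-1 <= cos `|t|.
  rewrite -cos_pi3 leNgt ltr_cos ?in_itv /= ?normr_ge0 -?leNgt //=; lra.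
nra.
Qed.

Lemma count_mod1_le (R : realType) (x : R) N m :
  (count_mod1 (fun n : nat => x * (nth_prime n)%:R) (3^-1) (2 / 3) N m)%:R
  <= \sum_(i < N) 4 / 9 * (1 - cosf (nth_prime (m + i.+1))%:Z x) ^+ 2.
Proof.
rewrite /count_mod1 -sum1_count natr_sum big_mkcond big_add1 /= big_mkord.
apply: ler_sum => i _; case: ifP => [/middle_third_le_cos|_].
  rewrite /cosf addnS addnC /= -pmulrn.
  by rewrite [2 * pi * (x * _)]mulrCA [x * _]mulrC.
by rewrite mulr_ge0 // ?divr_ge0 // sqr_ge0.
Qed.

Lemma not_well_distributed_of_bias (R : realType) (x : R) :
  (forall N : nat, exists n, (N <= n)%N /\ exists m,
    \sum_(i < n.+1) 4 / 9 * (1 - cosf (nth_prime (m + i.+1))%:Z x) ^+ 2 < n.+1%:R / 4) ->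
  ~ well_distributed_mod1 (fun n : nat => x * (nth_prime n)%:R).
Proof.
move=> bias wd.
have := wd 3^-1 (2 / 3) ltac:(lra) ltac:(lra) ltac:(lra).
set s := fun n : nat => x * (nth_prime n)%:R.
move/cvgrPdist_lt => /(_ 12^-1 ltac:(lra)) [N _ HN].
have [n [Nn [m hm]]] := bias N.
have := HN n.+1 (leqW Nn); rewrite sub0r normrN ltNge => /negP; apply.
set S := sup _.
have hS : `|(count_mod1 s 3^-1 (2 / 3) n.+1 m)%:R / n.+1%:R - (2 / 3 - 3^-1)| <= S.
  apply: ub_le_sup; last by exists m.
  exists (2 : R) => _ [m' _ <-]; rewrite ler_norml.
  have : 0 <= ((count_mod1 s 3^-1 (2 / 3) n.+1 m')%:R / n.+1%:R : R) <= 1.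
    rewrite divr_ge0 //= ler_pdivrMr ?ltr0n // mul1r ler_nat /count_mod1.
    by apply: leq_trans (count_size _ _) _; rewrite size_iota subSS subn0.
  by move: (_ / n.+1%:R : R) => A /andP[h1 h2]; apply/andP; split; lra.
apply: le_trans (ler_norm S); apply: le_trans hS; rewrite ler_normr; apply/orP; right.
have : (count_mod1 s 3^-1 (2 / 3) n.+1 m)%:R / n.+1%:R < (4^-1 : R).
  by rewrite ltr_pdivrMr ?ltr0n // [ltRHS]mulrC; apply: le_lt_trans (count_mod1_le x n.+1 m) hm.
move: (_ / n.+1%:R : R) => A; lra.
Qed.

Lemma continuous_sum_cosf (R : realType) (I : Type) (s : seq I) (q : I -> int) :
  continuous (fun x : R => \sum_(i <- s) 4 / 9 * (1 - cosf (q i) x) ^+ 2).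
Proof.
have c i : continuous (fun x : R => 1 - cosf (q i) x).
  move=> x; apply: cvgB; first exact: cvg_cst.
  apply: (@continuous_comp _ _ _ (fun x => 2 * pi * (q i)%:~R * x) cos).
    by apply: cvgM; [exact: cvg_cst | exact: cvg_id].
  exact: continuous_cos.
elim: s => [|i s IH] x.
  rewrite (_ : (fun _ => _) = cst 0); first exact: cvg_cst.
  by apply/funext => y; rewrite big_nil.
rewrite (_ : (fun _ => _) = fun x => 4 / 9 * ((1 - cosf (q i) x) * (1 - cosf (q i) x))
    + \sum_(i <- s) 4 / 9 * (1 - cosf (q i) x) ^+ 2).
  by apply: cvgD (IH x); apply: cvgM; [exact: cvg_cst | apply: cvgM; exact: c].
by apply/funext => y; rewrite big_cons expr2.
Qed.

Definition biased_set (R : realType) (N : nat) : set R :=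
  [set x | exists n, (N <= n)%N /\ exists m,
    \sum_(i < n.+1) 4 / 9 * (1 - cosf (nth_prime (m + i.+1))%:Z x) ^+ 2 < n.+1%:R / 4]%classic.

Lemma open_biased_set (R : realType) N : open (@biased_set R N).
Proof.
rewrite /biased_set openE => x [n [Nn [m hm]]].
have := @continuous_sum_cosf R _ (index_enum 'I_n.+1) (fun i => (nth_prime (m + i.+1))%:Z) x.
move=> /(@cvgr_lt _ _ _ _ _ _) /(_ _ hm).
apply: filterS => y hy; exists n; split => //; exists m; exact: hy.
Qed.

Lemma dense_biased_set (R : realType) N : dense (@biased_set R N).
Proof.
move=> O [x Ox] oO; have := open_nbhs_nbhs (conj oO Ox).
move=> /nbhs_ballP[e /= e0 he].
have [y [y1 y2 [m hm]]] := @exists_biased_window R N (x - e) (x + e) ltac:(lra).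
exists y; split.
  by apply: he; rewrite /ball /= ltr_distlC; lra.
by exists N.+1; split => //; exists m.
Qed.

Theorem theorem1p1 (R : realType) :
  exists alpha : R, irrational alpha /\
    ~ well_distributed_mod1 (fun n : nat => alpha * (nth_prime n)%:R).
Proof.
have [F FO irrE] := @irrational_Gdelta R.
pose G i : set R := if odd i then F i./2 else @biased_set R i./2.
have GO i : open (G i) /\ dense (G i).
  rewrite /G; case: (odd i); first exact: FO.
  by split; [exact: open_biased_set | exact: dense_biased_set].
have [x [_ Gx]] := Baire GO (ex_intro (fun x : R => [set: R]%classic x) 0 I) openT.
exists x; split.
  rewrite irrE => i _; have := Gx i.*2.+1 I.
  by rewrite /G /= odd_double /= uphalf_double.
apply: not_well_distributed_of_bias => N.
by have := Gx N.*2 I; rewrite /G odd_double doubleK.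
Qed.
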